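(* Let $(X_1,Y_1),(X_2,Y_2),\dots$ be a random sample (i.i.d. copies) of a random vector $(X,Y)$ with continuous joint distribution function $H$, marginal distribution functions $F$ and $G$, and (unique) copula $A$. Assume that $A$ allows a continuous Markov kernel $K_A$, define $K_H(x,(-\infty,y]):=K_A(F(x),[0,G(y)])$, and set $N(n):=\lfloor n^s\rfloor$ for some $s\in(0,\tfrac12)$. Fix $\tau\in(0,1)$ and for $x\in\mathbb{R}$ define $$\underline q^\tau(x):=\sup\{y\in\mathbb{R}:K_H(x,(-\infty,y])<\tau\},\quad \overline q^\tau(x):=\inf\{y\in\mathbb{R}:K_H(x,(-\infty,y])>\tau\},$$ $$\underline q_n^\tau(x):=\sup\{y\in\mathbb{R}:K_{\mathcal{CB}_{N(n)}(E_n)}(F_n(x),[0,G_n(y)])<\tau\},\quad \overline q_n^\tau(x):=\inf\{y\in\mathbb{R}:K_{\mathcal{CB}_{N(n)}(E_n)}(F_n(x),[0,G_n(y)])>\tau\}.$$ Then for every $x\in\mathbb{R}$, almost surely, $$\lim_{n\to\infty}\max_{y_n\in[\underline q_n^\tau(x),\overline q_n^\tau(x)]}\ \min_{y\in[\underline q^\tau(x),\overline q^\tau(x)]}|y_n-y|=0.$$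
   Context: A (bivariate) copula is a distribution function on $[0,1]^2$ with uniform marginals; each copula $B$ corresponds to a doubly stochastic measure $\mu_B$ with $B(x,y)=\mu_B([0,x]\times[0,y])$. A Markov kernel of a copula $B$ is a map $K_B:[0,1]\times\mathcal{B}([0,1])\to[0,1]$, measurable in the first argument, a probability measure in the second, with $\int_{E_1}K_B(x,E_2)\,d\lambda(x)=\mu_B(E_1\times E_2)$ for all Borel $E_1,E_2\subseteq[0,1]$ ($\lambda$ = Lebesgue measure). $A$ allows a continuous Markov kernel if it has a version $K_A$ with $(x,y)\mapsto K_A(x,[0,y])$ continuous on $[0,1]^2$; $K_A$ denotes this version. Checkerboard approximation: $I_1^N=[0,\tfrac1N]$, $I_i^N=(\tfrac{i-1}N,\tfrac iN]$ ($i=2,\dots,N$), $Q_{i,j}^N=I_i^N\times I_j^N$; for a copula $B$, $K_{\mathcal{CB}_N(B)}(u,[0,v])=N^2\sum_{i,j=1}^N\mu_B(Q^N_{i,j})\mathbf 1_{I^N_i}(u)\,\lambda([0,v]\cap I^N_j)$ is the Markov kernel of the absolutely continuous copula $\mathcal{CB}_N(B)$ with density $N^2\sum_{i,j}\mu_B(Q^N_{i,j})\mathbf 1_{Q^N_{i,j}}$. $F_n,G_n$ are the univariate empirical distribution functions of the first $n$ observations; $E_n$ is the empirical copula: with $H_n$ the bivariate empirical distribution function, almost surely there is a unique subcopula $E_n'$ on $\{0,\tfrac1n,\dots,1\}^2$ with $H_n(x,y)=E_n'(F_n(x),G_n(y))$, and $E_n$ is its extension to a copula by bilinear interpolation on each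 square $[\tfrac{i-1}n,\tfrac in]\times[\tfrac{j-1}n,\tfrac jn]$. *)

(* Defs.v *)
From HB Require Import structures.
From mathcomp Require Import all_boot all_order all_algebra.
From mathcomp Require Import all_classical all_reals all_analysis.
Set Implicit Arguments.
Unset Strict Implicit.
Unset Printing Implicit Defensive.
Import Order.TTheory GRing.Theory Num.Theory.
Import numFieldNormedType.Exports.
Local Open Scope classical_set_scope.
Local Open Scope ring_scope.

Section Defs.
Context {R : realType}.

Definition is_copula (A : R -> R -> R) : Prop :=
  (forall u, 0 <= u <= 1 ->
     A u 0 = 0 /\ A 0 u = 0 /\ A u 1 = u /\ A 1 u = u) /\
  (forall u1 u2 v1 v2, 0 <= u1 -> u1 <= u2 -> u2 <= 1 ->
     0 <= v1 -> v1 <= v2 -> v2 <= 1 ->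
     0 <= A u2 v2 - A u1 v2 - A u2 v1 + A u1 v1).

(** k u v plays the role of K_A(u,[0,v]) for a continuous Markov kernel K_A
    of the copula A: for each u in [0,1], v |-> k u v is the distribution
    function of a probability measure on [0,1]; (u,v) |-> k u v is continuous
    on [0,1]^2; and the kernel identity
    int_{[0,u]} K_A(t,[0,v]) dt = mu_A([0,u] x [0,v]) = A(u,v) holds. *)
Definition continuous_markov_kernel_of (A : R -> R -> R) (k : R -> R -> R) : Prop :=
  {within [set p : R * R | 0 <= p.1 <= 1 /\ 0 <= p.2 <= 1],
     continuous (fun p : R * R => k p.1 p.2)} /\
  (forall u, 0 <= u <= 1 ->
     0 <= k u 0 /\ k u 1 = 1 /\
     (forall v w, 0 <= v -> v <= w -> w <= 1 -> k u v <= k u w)) /\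
  (forall u v, 0 <= u <= 1 -> 0 <= v <= 1 ->
     (\int[@lebesgue_measure R]_(t in [set t : R | (0 <= t <= u)%R]) (k t v)%:E
        = (A u v)%:E)%E).

Definition distr_fun {d} {T : measurableType d} (P : probability T R) (X : T -> R)
    (x : R) : R :=
  fine (P [set w | X w <= x]).

Definition joint_cdf {d} {T : measurableType d} (P : probability T R)
    (X Y : T -> R) (x y : R) : R :=
  fine (P [set w | X w <= x /\ Y w <= y]).

Definition iid_sample {d} {T : measurableType d} (P : probability T R)
    (X Y : T -> R) (Xs Ys : nat -> T -> R) : Prop :=
  (forall i (B : set (R * R)), measurable B ->
     P ((fun w => (Xs i w, Ys i w)) @^-1` B) = P ((fun w => (X w, Y w)) @^-1` B)) /\
  (forall (I : seq nat) (B : nat -> set (R * R)), uniq I ->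
     (forall i, measurable (B i)) ->
     P (\bigcap_(i in [set` I]) ((fun w => (Xs i w, Ys i w)) @^-1` B i))
     = \big[*%E/1%E]_(i <- I) P ((fun w => (Xs i w, Ys i w)) @^-1` B i)).

Definition emp_count {T} (Xs : nat -> T -> R) (n : nat) (w : T) (x : R) : nat :=
  (\sum_(i < n) ((Xs i w <= x)%R : nat))%N.

Definition emp_cdf {T} (Xs : nat -> T -> R) (n : nat) (w : T) (x : R) : R :=
  (emp_count Xs n w x)%:R / n%:R.

Definition emp_joint_cdf {T} (Xs Ys : nat -> T -> R) (n : nat) (w : T)
    (x y : R) : R :=
  (\sum_(i < n) (((Xs i w <= x) && (Ys i w <= y))%R : nat))%N%:R / n%:R.

(** a subcopula on the grid {0,1/n,...,1}^2; S i j is its value at (i/n, j/n) *)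
Definition grid_subcopula (n : nat) (S : nat -> nat -> R) : Prop :=
  (forall j, (j <= n)%N ->
     S 0%N j = 0 /\ S j 0%N = 0 /\ S n j = j%:R / n%:R /\ S j n = j%:R / n%:R) /\
  (forall i1 i2 j1 j2, (i1 <= i2 <= n)%N -> (j1 <= j2 <= n)%N ->
     0 <= S i2 j2 - S i1 j2 - S i2 j1 + S i1 j1).

Definition empirical_subcopula {d} {T : measurableType d} (P : probability T R)
    (Xs Ys : nat -> T -> R) (S : nat -> T -> nat -> nat -> R) : Prop :=
  {ae P, forall w, forall n, (0 < n)%N ->
     grid_subcopula n (S n w) /\
     forall x y, emp_joint_cdf Xs Ys n w x y
                 = S n w (emp_count Xs n w x) (emp_count Ys n w y)}.

(** extension of a grid subcopula to a copula by bilinear interpolation on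
    each square [(i-1)/n,i/n] x [(j-1)/n,j/n] *)
Definition bilinear_ext (n : nat) (S : nat -> nat -> R) (u v : R) : R :=
  let a := minn (Num.truncn (u * n%:R)) n.-1 in
  let b := minn (Num.truncn (v * n%:R)) n.-1 in
  let t := u * n%:R - a%:R in
  let r := v * n%:R - b%:R in
  (1 - t) * (1 - r) * S a b + t * (1 - r) * S a.+1 b
  + (1 - t) * r * S a b.+1 + t * r * S a.+1 b.+1.

Definition rect_mass (B : R -> R -> R) (a b c d : R) : R :=
  B b d - B a d - B b c + B a c.

(** indicator of I^N_{i+1} (0-based index i) *)
Definition ind_I (N i : nat) (u : R) : R :=
  if i == 0%N then (if (0 <= u) && (u <= 1 / N%:R) then 1 else 0)
  else (if (i%:R / N%:R < u) && (u <= i.+1%:R / N%:R) then 1 else 0).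

(** lambda([0,v] cap I^N_{j+1}) (0-based index j) *)
Definition leb_I (N j : nat) (v : R) : R :=
  Num.max 0 (Num.min v (j.+1%:R / N%:R) - j%:R / N%:R).

Definition cb_kernel (N : nat) (B : R -> R -> R) (u v : R) : R :=
  (N%:R ^+ 2) * \sum_(i < N) \sum_(j < N)
     rect_mass B (i%:R / N%:R) (i.+1%:R / N%:R) (j%:R / N%:R) (j.+1%:R / N%:R)
     * ind_I N i u * leb_I N j v.

Definition Nn (s : R) (n : nat) : nat := Num.truncn (n%:R `^ s).

Definition qlow (tau : R) (K : R -> R) : R := sup [set y | K y < tau].
Definition qup (tau : R) (K : R -> R) : R := inf [set y | tau < K y].

Definition excess (a b c d : R) : R :=
  sup [set inf [set `|yn - y| | y in [set y | c <= y <= d]]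
      | yn in [set yn | a <= yn <= b]].

End Defs.

(* Main.v *)
Require Import Defs.
From HB Require Import structures.
From mathcomp Require Import all_boot all_order all_algebra.
From mathcomp Require Import all_classical all_reals all_analysis.
From mathcomp Require Import measurable_realfun.
From mathcomp Require Import ring lra.
Import Order.TTheory GRing.Theory Num.Theory.
Import numFieldNormedType.Exports.
Local Open Scope classical_set_scope.
Local Open Scope ring_scope.

(** By telescoping over the columns of the checkerboard, the empirical kernel at
    (F_n x, G_n y) is N times a convex combination of two increments
    E_n((i+1)/N, j/N) - E_n(i/N, j/N), with no N^2 prefactor left, while the same
    increment of A is the integral of K_A(., [0, j/N]) over a cell of length 1/N.
    Hence the kernel converges at a fixed (x, y) as soon as the error of E_n on the
    N x N grid is o(1/N).  Sampling F and G at approximate i/N-quantiles reduces that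
    error to deviations of empirical frequencies of O(N^2) fixed sets; these are
    Bernoulli sums, exponentially concentrated at scale n^(-1/2) = o(1/N) because
    s < 1/2, so Borel-Cantelli applies.  Finally, the excess only depends on
    K_n(qlow - e) < tau < K_n(qup + e) for e = 1/m, countably many points y. *)

(** * Concentration of Bernoulli sums *)

(** The sets whose frequencies are tested move with [n], so a strong law for a fixed set says
    nothing about them; explicit tail bounds that can be summed over [n] take its place. A second
    obstacle is that [E_n] is accessible only through counts: its subcopula at ([emp_count] of x,
    [emp_count] of y) is the joint empirical distribution function at (x, y), whereas the kernel
    needs it at (i/N, j/N). Quantile points of F and G, chosen before sampling, keep the tested sets
    deterministic, and the 1-Lipschitz property of both A and the subcopula absorbs the gaps between
    i/N, F(x) and F_n(x). Interpolation costs a further 2/n, harmless since N/n tends to 0. Finally,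
    [sup] and [inf] of an unbounded real set take a default value, so the kernels must be controlled
    at both ends of the line. For [K_A] this includes showing that it puts no mass at 0, which the
    definition does not state. *)

Lemma expR_le_quad (R : realType) (x : R) : x <= 1 / 2 -> expR x <= 1 + x + 2 * x ^+ 2.
Proof.
move=> x2; have x1 : 0 < 1 - x by lra.
have h : 1 - x <= expR (- x) by have := expR_ge1Dx (- x).
rewrite -[x in expR x]opprK expRN.
apply: (@le_trans _ _ (1 - x)^-1); first by rewrite lef_pV2 ?posrE ?expR_gt0.
rewrite -[_^-1]mul1r ler_pdivrMr//.
(* (1 - x)(1 + x + 2x^2) = 1 + x^2 (1 - 2x), which is at least 1 because x <= 1/2. *)
nra.
Qed.

(** The variable is centred, so the linear terms of the two quadratic bounds cancel and 1 + 2 l^2 p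
    (1 - p) is left. The constant 2 is not sharp; only the order l^2 matters. *)
Lemma mgf_bernoulli (R : realType) (p l : R) : 0 <= p <= 1 -> `|l| <= 1 / 2 ->
  p * expR (l * (1 - p)) + (1 - p) * expR (- (l * p)) <= expR (2 * l ^+ 2).
Proof.
move=> /andP[p0 p1]; rewrite ler_norml => /andP[l0 l1].
have h1 : expR (l * (1 - p)) <= 1 + (l * (1 - p)) + 2 * (l * (1 - p)) ^+ 2.
  by apply: expR_le_quad; nra.
have h2 : expR (- (l * p)) <= 1 + (- (l * p)) + 2 * (- (l * p)) ^+ 2.
  by apply: expR_le_quad; nra.
apply: le_trans (expR_ge1Dx _).
have q0 : 0 <= 1 - p by lra.
apply: (le_trans (lerD (ler_wpM2l p0 h1) (ler_wpM2l q0 h2))).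
have -> : p * (1 + l * (1 - p) + 2 * (l * (1 - p)) ^+ 2) +
  (1 - p) * (1 - l * p + 2 * (- (l * p)) ^+ 2) = 1 + (2 * l ^+ 2) * (p * (1 - p)) by ring.
rewrite lerD2l; have := sqr_ge0 l => ?; apply: ler_piMr; first lra.
by nra.
Qed.

(** The probability that, among [n] independent trials of success probability [p], exactly those in
    [J] succeed. Working with weights on subsets turns expectations into finite sums. *)
Definition bernoulli_weight (R : realType) (n : nat) (p : R) (J : {set 'I_n}) : R :=
  \prod_(i < n) (if i \in J then p else 1 - p).

Lemma bernoulli_weight_ge0 (R : realType) n (p : R) (J : {set 'I_n}) :
  0 <= p <= 1 -> 0 <= bernoulli_weight R n p J.
Proof.
by move=> /andP[p0 p1]; apply: prodr_ge0 => i _; case: ifP => // _; rewrite subr_ge0.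
Qed.

(** Expanding a product of [n] one-trial sums by distributivity gives exactly this sum over [J], so
    the one-trial bound is raised to the power [n]. *)
Lemma mgf_bernoulli_weight (R : realType) n (p l : R) : 0 <= p <= 1 -> `|l| <= 1 / 2 ->
  \sum_(J : {set 'I_n}) expR (l * (#|J|%:R - n%:R * p)) * bernoulli_weight R n p J
  <= expR (2 * l ^+ 2 * n%:R).
Proof.
move=> p01 l2; rewrite expRM_natr.
apply: (@le_trans _ _ (\prod_(i < n)
  (p * expR (l * (1 - p)) + (1 - p) * expR (- (l * p))))); last first.
  rewrite prodr_const card_ord; apply: lerXn2r; rewrite ?nnegrE ?expR_ge0//.
    by move: p01 => /andP[p0 p1]; rewrite addr_ge0// mulr_ge0 ?expR_ge0 ?subr_ge0.
  exact: mgf_bernoulli.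
rewrite bigA_distr; apply: ler_sum => J _.
rewrite /bernoulli_weight.
have -> : expR (l * (#|J|%:R - n%:R * p)) =
   \prod_(i < n) expR (if i \in J then l * (1 - p) else - (l * p)).
  rewrite -expR_sum; congr expR.
  rewrite (eq_bigr (fun i => l * ((i \in J)%:R - p))); last first.
    by move=> i _; case: ifP => _ /=; ring.
  rewrite -mulr_sumr sumrB sumr_const card_ord -[p *+ n]mulr_natl.
  by congr (_ * (_ - _)); rewrite -natr_sum -sum1_card [in LHS]big_mkcond.
rewrite -big_split/= le_eqVlt; apply/orP; left; apply/eqP; apply: eq_bigr => i _.
by case: ifP => _; rewrite mulrC.
Qed.

Lemma bernoulli_tail (R : realType) n (p eps : R) : 0 <= p <= 1 -> 0 <= eps <= 1 ->
  \sum_(J : {set 'I_n} | (n%:R * eps < `|#|J|%:R - n%:R * p|)%R) bernoulli_weight R n p J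
  <= 2 * expR (- (n%:R * eps ^+ 2 / 8)).
Proof.
move=> p01 /andP[e0 e1].
(* Chernoff parameter: eps/4 minimises 2 l^2 - l eps, with value -eps^2/8. The two signs of [l]
   treat the two tails and produce the factor 2. *)
have [l lE] : exists l, l = eps / 4 by exists (eps / 4).
have l2 : `|l| <= 1 / 2 by rewrite ger0_norm lE; lra.
have l2' : `|- l| <= 1 / 2 by rewrite normrN.
have h1 := mgf_bernoulli_weight R n p l p01 l2.
have h2 := mgf_bernoulli_weight R n p (- l) p01 l2'.
apply: (@le_trans _ _ (expR (- (l * (n%:R * eps))) *
   (\sum_(J : {set 'I_n}) expR (l * (#|J|%:R - n%:R * p)) * bernoulli_weight R n p J +
    \sum_(J : {set 'I_n}) expR (- l * (#|J|%:R - n%:R * p)) * bernoulli_weight R n p J))).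
  rewrite -big_split/= mulr_sumr big_mkcond/=; apply: ler_sum => J _.
  rewrite -mulrDl mulrA mulrDr -!expRD; case: ifPn => [h|_]; last first.
    by rewrite mulr_ge0 ?bernoulli_weight_ge0// addr_ge0 ?expR_ge0.
  rewrite ler_peMl ?bernoulli_weight_ge0//.
  have l0 : 0 <= l by rewrite lE; lra.
  have [c|c] := leP 0 (#|J|%:R - n%:R * p).
    rewrite ger0_norm// -subr_gt0 in h; have h' := mulr_ge0 l0 (ltW h).
    have : 1 <= expR (- (l * (n%:R * eps)) + l * (#|J|%:R - n%:R * p)).
      by rewrite -[leLHS]expR0 ler_expR; lra.
    by have := expR_ge0 (- (l * (n%:R * eps)) + - l * (#|J|%:R - n%:R * p)); lra.
  rewrite ltr0_norm// -subr_gt0 in h; have h' := mulr_ge0 l0 (ltW h).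
  have : 1 <= expR (- (l * (n%:R * eps)) + - l * (#|J|%:R - n%:R * p)).
    by rewrite -[leLHS]expR0 ler_expR; lra.
  by have := expR_ge0 (- (l * (n%:R * eps)) + l * (#|J|%:R - n%:R * p)); lra.
apply: (@le_trans _ _ (expR (- (l * (n%:R * eps))) * (2 * expR (2 * l ^+ 2 * n%:R)))).
  by rewrite ler_wpM2l ?expR_ge0//; rewrite sqrrN in h2; lra.
rewrite mulrCA -expRD ler_wpM2l// ler_expR lE; lra.
Qed.

(** * Empirical frequencies of an i.i.d. sample *)

Lemma measure_le_cover d (T : measurableType d) (R : realType)
  (P : {measure set T -> \bar R}) (I : eqType) (s : seq I) (A : set T) (F : I -> set T) :
  measurable A -> (forall i, measurable (F i)) ->
  (forall w, A w -> exists2 i, i \in s & F i w) ->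
  (P A <= \sum_(i <- s) P (F i))%E.
Proof.
move=> mA mF; elim: s A mA => [|i s IH] A mA As.
  rewrite big_nil (_ : A = set0) ?measure0// -subset0 => w /As[].
  by move=> ? //.
rewrite big_cons.
apply: (@le_trans _ _ (P (F i `|` (A `\` F i)))).
  apply: le_measure; rewrite ?inE//; first by apply: measurableU => //; exact: measurableD.
  by move=> w Aw; have [|] := pselect (F i w); [left|right].
apply: le_trans; first by apply: measureU2 => //; exact: measurableD.
apply: leeD2l; apply: IH; first exact: measurableD.
move=> w [/As[j]]; rewrite inE => /orP[/eqP -> //|js Fj] _.
by exists j.
Qed.

Definition hits {T U : Type} (Z : nat -> T -> U) (B : set U) (n : nat) (w : T) : nat :=
  (\sum_(i < n) (`[< B (Z i w) >] : nat))%N.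

Section deviations.
Context (R : realType) (d : measure_display) (T : measurableType d)
  (P : probability T R) (X Y : T -> R) (Xs Ys : nat -> T -> R)
  (mX : measurable_fun setT X) (mY : measurable_fun setT Y)
  (mXs : forall i, measurable_fun setT (Xs i))
  (mYs : forall i, measurable_fun setT (Ys i))
  (hiid : iid_sample P X Y Xs Ys).

Let Z i w := (Xs i w, Ys i w).

Definition law (B : set (R * R)) : R := fine (P ((fun w => (X w, Y w)) @^-1` B)).

Let mZ i (B : set (R * R)) : measurable B -> measurable (Z i @^-1` B).
Proof.
by move=> mB; rewrite -[_ @^-1` _]setTI; apply: (measurable_fun_pair (mXs i) (mYs i)).
Qed.

Let mXY (B : set (R * R)) : measurable B -> measurable ((fun w => (X w, Y w)) @^-1` B).
Proof.
by move=> mB; rewrite -[_ @^-1` _]setTI; apply: (measurable_fun_pair mX mY).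
Qed.

Lemma law01 B : measurable B -> 0 <= law B <= 1.
Proof.
move=> mB; rewrite /law fine_ge0 ?measure_ge0//= -lee_fin fineK ?probability_le1//.
  exact: mXY.
by rewrite fin_num_measure//; exact: mXY.
Qed.

Let atom (B : set (R * R)) n (J : {set 'I_n}) : set T :=
  [set w | forall i : 'I_n, `[< B (Z i w) >] = (i \in J)].

(* Independence is used with each coordinate event either [B] or its complement. *)
Let atomE B n (J : {set 'I_n}) : measurable B ->
  measurable (atom B n J) /\ P (atom B n J) = (bernoulli_weight R n (law B) J)%:E.
Proof.
move=> mB.
pose C i := if insub i is Some i' then
   if (i' : 'I_n) \in J then B else ~` B else setT.
have mC i : measurable (C i).
  by rewrite /C; case: insub => // i'; case: ifP => // _; exact: measurableC.
have -> : atom B n J = \bigcap_(i in [set` iota 0 n]) (Z i @^-1` C i).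
  apply/seteqP; split=> w /=.
    move=> h i /=; rewrite mem_iota /= add0n => ilt.
    rewrite /C insubT/=; have := h (Ordinal ilt).
    by case: ifP => _ /asboolP.
  move=> h i; have := h i; rewrite /= mem_iota/= add0n ltn_ord => /(_ isT).
  rewrite /C (valK i) /=.
  by case: ifP => _ => [?|?]; [apply/asboolP|apply/asboolPn].
split; first by apply: fin_bigcap_measurable => // i _; exact: mZ.
rewrite hiid.2 ?iota_uniq//.
rewrite (_ : iota 0 n = index_iota 0 n); last by rewrite /index_iota subn0.
rewrite big_mkord /bernoulli_weight -prodEFin; apply: eq_bigr => i _.
rewrite hiid.1// /C (valK i).
have mB' := mXY B mB; have fP := fin_num_measure P _ mB'.
case: ifP => _; first by rewrite /law fineK.
by rewrite preimage_setC probability_setC// EFinB /law fineK.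
Qed.

Definition deviates (B : set (R * R)) n (e : R) : set T :=
  [set w | n%:R * e < `|(hits Z B n w)%:R - n%:R * law B|].

Let hits_atom B n w (J : {set 'I_n}) : atom B n J w -> hits Z B n w = #|J|.
Proof.
move=> h; rewrite /hits -sum1_card [in RHS]big_mkcond; apply: eq_bigr => i _.
by rewrite h; case: (i \in J).
Qed.

Let deviatesE B n e : deviates B n e =
  \bigcup_(J in [set J : {set 'I_n} | n%:R * e < `|(#|J|)%:R - n%:R * law B|])
    atom B n J.
Proof.
apply/seteqP; split=> w /=.
  move=> h; pose J := finset (fun i : 'I_n => `[< B (Z i w) >]).
  have aJ : atom B n J w by move=> i; rewrite inE.
  by exists J => //=; rewrite -(hits_atom _ _ _ _ aJ).
by move=> [J /= h aJ]; rewrite /deviates /mkset (hits_atom _ _ _ _ aJ).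
Qed.

Lemma measurable_deviates B n e : measurable B -> measurable (deviates B n e).
Proof.
by move=> mB; rewrite deviatesE; apply: fin_bigcup_measurable => // J _; apply: (atomE _ _ _ mB).1.
Qed.

(** The event is a finite union of atoms, one for each possible set of hit indices, and each atom
    has the corresponding Bernoulli weight; the tail bound for weights thus becomes one for [P]. *)
Lemma deviates_le B n e : measurable B -> 0 <= e <= 1 ->
  (P (deviates B n e) <= (2 * expR (- (n%:R * e ^+ 2 / 8)))%:E)%E.
Proof.
move=> mB e01.
pose s := enum [pred J : {set 'I_n} | n%:R * e < `|(#|J|)%:R - n%:R * law B|].
apply: (@le_trans _ _ (\sum_(J <- s) P (atom B n J))%E).
  apply: measure_le_cover; first exact: measurable_deviates.
    by move=> J; exact: (atomE _ _ _ mB).1.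
  by move=> w; rewrite deviatesE => -[J /= hJ aJ]; exists J; rewrite // mem_enum.
rewrite big_enum/=; under eq_bigr => J _ do rewrite (atomE _ _ _ mB).2.
by rewrite sumEFin lee_fin; apply: bernoulli_tail; rewrite ?law01.
Qed.

End deviations.

(** The majorant is D (1/(k+1) - 1/(k+2)), so partial sums are at most D. The shift by one keeps the
    term k = 0 meaningful. *)
Lemma nneseries_lt_pinfty_telescope (R : realType) (u : nat -> \bar R) (D : R) :
  0 <= D -> (forall k, 0 <= u k)%E ->
  (forall k, u k <= (D / (k.+1%:R * k.+2%:R))%:E)%E ->
  (\sum_(k <oo) u k < +oo)%E.
Proof.
move=> D0 u0 uD.
have h n : (\sum_(0 <= k < n) u k <= (D * (1 - n.+1%:R^-1))%:E)%E.
  elim: n => [|n IH]; first by rewrite big_geq// invr1 subrr mulr0.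
  rewrite big_nat_recr//=; apply: (le_trans (leeD IH (uD n))).
  rewrite -EFinD lee_fin -mulrDr ler_wpM2l//.
  rewrite le_eqVlt; apply/orP; left; apply/eqP.
  rewrite -[n.+2%:R]natr1; have := ltr0Sn R n; move: (n.+1%:R) => z z0.
  by field; apply/andP; split; lra.
apply: (@le_lt_trans _ _ D%:E); last exact: ltry.
apply: lime_le; first exact: is_cvg_nneseries.
apply: nearW => n; apply: (le_trans (h n)).
by rewrite lee_fin ler_piMr// gerBl.
Qed.

Lemma Nn_le_powR (R : realType) (s : R) n : (Nn s n)%:R <= n%:R `^ s.
Proof. by rewrite /Nn truncn_le// powR_ge0. Qed.

Lemma Nn_gt0 (R : realType) (s : R) n : 0 <= s -> (0 < n)%N -> (0 < Nn s n)%N.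
Proof.
move=> s0 n0; rewrite /Nn truncn_gt0 -[leLHS](powRr0 n%:R).
by rewrite ler_powR// ler1n.
Qed.

Lemma Nn_sqr_le (R : realType) (s : R) n : s <= 1 / 2 -> (0 < n)%N ->
  (Nn s n)%:R ^+ 2 <= n%:R `^ (2 * s).
Proof.
move=> s2 n0; rewrite mulrC powRrM (powR_mulrn 2) ?powR_ge0//.
by apply: lerXn2r; rewrite ?nnegrE ?powR_ge0 ?Nn_le_powR.
Qed.

(* [n / N ^ 2 >= n `^ (1 - 2 * s)], so the exponential beats the [(N + 1) ^ 2] terms of the
   union bound; this is where [s < 1 / 2] enters. *)
Lemma tail_summable (R : realType) (s e : R) : 0 < s < 1 / 2 -> 0 < e ->
  exists2 D : R, 0 <= D & forall n,
    (Nn s n).+1%:R ^+ 2 * (2 * expR (- (n%:R * (e / (Nn s n)%:R) ^+ 2 / 8)))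
    <= D / (n.+1%:R * n.+2%:R).
Proof.
move=> /andP[s0 s2] e0.
have a0 : 0 < 1 - 2 * s by lra.
set a := 1 - 2 * s in a0.
(* From exp(t) >= t^M / M! with t = c n^a and aM >= 3, the exponential is O(n^-3). Against (N + 1)^2
   <= 4n this leaves O(n^-2). *)
pose M := (Num.truncn (3 / a)).+1.
have aM : 3 <= a * M%:R.
  by rewrite mulrC -ler_pdivrMr// ltW// truncnS_gt.
have [c cE] : exists c, c = e ^+ 2 / 8 by eexists.
have c0 : 0 < c by rewrite cE divr_gt0// exprn_gt0.
have [K KE] : exists K, K = M`!%:R / c ^+ M by eexists.
have K0 : 0 <= K by rewrite KE divr_ge0// exprn_ge0// ltW.
(* For n >= 1 the bound is 8K/n^2, and (n+1)(n+2) <= 6n^2 gives 48K. The summand 4 covers n = 0,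
   where N = 0 and the term equals 2. *)
exists (48 * K + 4) => [|n]; first by lra.
have [->|n0] := posnP n.
  rewrite /Nn powR0 ?gt_eqF// truncn0 mul0r mul0r oppr0 expR0 expr1n; lra.
set N := Nn s n.
have N0 : (0 < N)%N by apply: Nn_gt0; rewrite ?ltW.
have N0' : 0 < N%:R :> R by rewrite ltr0n.
have n1 : 1 <= n%:R :> R by rewrite ler1n.
have n0' : 0 < n%:R :> R by lra.
have Nn2 : N%:R ^+ 2 <= n%:R `^ (2 * s) by apply: Nn_sqr_le; rewrite ?ltW.
have Nn1 : N%:R ^+ 2 <= n%:R :> R.
  apply: (le_trans Nn2); rewrite -[leRHS]powRr1; last exact: ltW.
  by rewrite ler_powR//; lra.
have e1 : (N.+1%:R : R) ^+ 2 <= 4 * n%:R.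
  have N1 : 1 <= N%:R :> R by rewrite ler1n.
  by rewrite -natr1; nra.
pose t := c * n%:R `^ a.
have t0 : 0 < t by rewrite /t mulr_gt0// powR_gt0.
have tle : t <= n%:R * (e / N%:R) ^+ 2 / 8.
  rewrite /t /a powRB; last by rewrite pnatr_eq0 -lt0n n0 implybT.
  rewrite powRr1; last exact: ltW.
  have -> : n%:R * (e / N%:R) ^+ 2 / 8 = c * (n%:R / N%:R ^+ 2).
    by rewrite cE; field; rewrite gt_eqF.
  rewrite ler_pM2l// ler_pM2l//.
  by rewrite lef_pV2 ?posrE ?powR_gt0 ?exprn_gt0.
have e2 : expR (- (n%:R * (e / N%:R) ^+ 2 / 8)) <= M`!%:R / t ^+ M.
  apply: (@le_trans _ _ (expR (- t))); first by rewrite ler_expR lerN2.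
  rewrite expRN -[leRHS]invrK invf_div lef_pV2 ?posrE ?expR_gt0//; last first.
    by rewrite divr_gt0 ?exprn_gt0// ltr0n fact_gt0.
  by apply: le_trans (@expR_ge1Dxn _ t (Num.truncn (3 / a)) (ltW t0)); rewrite -/M lerDr.
have e3 : c ^+ M * n%:R ^+ 3 <= t ^+ M.
  rewrite /t [leRHS]exprMn ler_pM2l ?exprn_gt0//.
  rewrite -(@powR_mulrn _ _ M (powR_ge0 _ _)) -powRrM.
  by rewrite -(@powR_mulrn _ _ 3 (ltW n0')) ler_powR.
have e4 : M`!%:R / t ^+ M <= (M`!%:R / c ^+ M) / n%:R ^+ 3.
  rewrite -mulrA ler_wpM2l// -invfM lef_pV2 ?posrE ?mulr_gt0 ?exprn_gt0//.
rewrite -KE in e4.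
apply: (@le_trans _ _ (4 * n%:R * (2 * (K / n%:R ^+ 3)))).
  apply: ler_pM; rewrite ?exprn_ge0 ?mulr_ge0 ?expR_ge0//.
  by rewrite ler_wpM2l//; exact: le_trans e2 e4.
have -> : 4 * n%:R * (2 * (K / n%:R ^+ 3)) = (8 * K) / n%:R ^+ 2.
  by field; rewrite gt_eqF.
rewrite ler_pdivrMr ?exprn_gt0// mulrAC ler_pdivlMr ?mulr_gt0//.
rewrite -natr1 -[n.+1%:R]natr1.
have h : (n%:R + 1) * (n%:R + 1 + 1) <= 6 * n%:R ^+ 2 :> R by nra.
have := ler_wpM2l K0 h.
have : 0 <= n%:R ^+ 2 :> R by exact: sqr_ge0.
lra.
Qed.

Lemma Nn_infty (R : realType) (s M : R) : 0 < s ->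
  \forall n \near \oo, M <= (Nn s n)%:R.
Proof.
move=> s0; have [K KE] : exists K, K = `|M| + 1 by eexists.
have K1 : 1 <= K by rewrite KE lerDr.
near=> n.
have nK : K `^ s^-1 <= n%:R by near: n; exact: nbhs_infty_ger.
have : K <= n%:R `^ s.
  rewrite -[leLHS]powRr1; last exact: le_trans K1.
  rewrite -[X in K `^ X](@mulVf _ s) ?gt_eqF// powRrM.
  by rewrite ge0_ler_powR ?nnegrE ?powR_ge0 ?(ltW s0).
have := truncnS_gt (n%:R `^ s); rewrite -natr1 -/(Nn s n) KE.
have := ler_norm M; lra.
Unshelve. all: end_near. Qed.

(** Once N >= 1/e, N/e <= N^2 <= n. This makes errors of order 1/n, from interpolation and from
    approximate quantiles, negligible after multiplication by N. *)
Lemma Nn_littleo (R : realType) (s e : R) : 0 < s < 1 / 2 -> 0 < e ->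
  \forall n \near \oo, (Nn s n)%:R <= e * n%:R.
Proof.
move=> /andP[s0 s2] e0; near=> n.
have n0 : (0 < n)%N by near: n; exact: (nbhs_infty_gt 0%N).
have Ne : e^-1 <= (Nn s n)%:R by near: n; exact: Nn_infty.
have N2 : (Nn s n)%:R ^+ 2 <= n%:R :> R.
  apply: (le_trans (Nn_sqr_le _ s n _ n0)); first exact: ltW.
  rewrite -[leRHS]powRr1//.
  have n1 : 1 <= n%:R :> R by rewrite ler1n.
  by rewrite ler_powR//; lra.
rewrite mulrC -ler_pdivrMr//; apply: le_trans N2; rewrite expr2.
by rewrite ler_wpM2l.
Unshelve. all: end_near. Qed.

(** * Borel-Cantelli for grids of sets that change with n *)

Section borel_cantelli_grid.
Context (R : realType) (d : measure_display) (T : measurableType d)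
  (P : probability T R) (X Y : T -> R) (Xs Ys : nat -> T -> R)
  (mX : measurable_fun setT X) (mY : measurable_fun setT Y)
  (mXs : forall i, measurable_fun setT (Xs i))
  (mYs : forall i, measurable_fun setT (Ys i))
  (hiid : iid_sample P X Y Xs Ys).
Context (s : R) (s_itv : 0 < s < 1 / 2)
  (B : nat -> nat -> nat -> set (R * R)) (mB : forall n i j, measurable (B n i j)).

Let N n := Nn s n.
Let dev n i j w : R :=
  (hits (fun i w => (Xs i w, Ys i w)) (B n i j) n w)%:R / n%:R - law _ _ _ P X Y (B n i j).

Let grid n := [seq (i, j) | i <- iota 0 n.+1, j <- iota 0 n.+1].

Let bad (e : R) n := \bigcup_(ij in [set` grid (N n)])
  deviates _ _ _ P X Y Xs Ys (B n ij.1 ij.2) n (e / (N n)%:R).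

Let mbad e n : measurable (bad e n).
Proof.
by apply: fin_bigcup_measurable => // ij _; apply: measurable_deviates.
Qed.

(** Union bound over the (N + 1)^2 grid indices. The threshold e/N is the precision that the kernel
    requires, since its increments are multiplied by N. *)
Let P_bad e n : 0 < e <= 1 ->
  (P (bad e n) <= ((N n).+1%:R ^+ 2 *
     (2 * expR (- (n%:R * (e / (N n)%:R) ^+ 2 / 8))))%:E)%E.
Proof.
move=> /andP[e0 e1].
have eN : 0 <= e / (N n)%:R <= 1.
  have [->|N0] := posnP (N n); first by rewrite invr0 mulr0 lexx ler01.
  rewrite divr_ge0 ?(ltW e0)//= ler_pdivrMr ?ltr0n// mul1r (le_trans e1)//.
  by rewrite ler1n.
apply: (@le_trans _ _ (\sum_(ij <- grid (N n))
   P (deviates _ _ _ P X Y Xs Ys (B n ij.1 ij.2) n (e / (N n)%:R)))%E).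
  apply: measure_le_cover; first exact: mbad.
    by move=> ij; exact: measurable_deviates.
  by move=> w [ij /= hij hw]; exists ij.
rewrite /grid big_allpairs/=.
apply: (@le_trans _ _ (\sum_(i <- iota 0 (N n).+1) \sum_(j <- iota 0 (N n).+1)
  (2 * expR (- (n%:R * (e / (N n)%:R) ^+ 2 / 8)))%:E)%E).
  by apply: lee_sum => i _; apply: lee_sum => j _; exact: deviates_le.
under eq_bigr do rewrite sumEFin.
rewrite sumEFin lee_fin !big_const_seq !count_predT !size_iota.
by rewrite !iter_addr_0 -mulrnA -[leLHS]mulr_natl natrM expr2.
Qed.

Let ae_not_bad e : 0 < e <= 1 -> {ae P, forall w, \forall n \near \oo, ~ bad e n w}.
Proof.
move=> e01.
have [D D0 hD] := tail_summable R s e s_itv (proj1 (andP e01)).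
exists (lim_sup_set (bad e)); split.
- by apply: bigcap_measurable => // k _; exact: bigcup_measurable.
- apply: lim_sup_set_cvg0 => //.
  apply: (nneseries_lt_pinfty_telescope _ _ D) => // k.
  by apply: (le_trans (P_bad e k e01)); rewrite lee_fin; exact: hD.
move=> w /= hw n _; apply: contrapT => hn; apply: hw.
exists n => // m /= nm bm; apply: hn; exists m => //.
Qed.

(** Borel-Cantelli is applied for each e = 1/(m+1); the countable union of exceptional sets is null,
    so one null set serves every e > 0. *)
Lemma ae_deviation_small : {ae P, forall w, forall e, 0 < e ->
  \forall n \near \oo, forall i j, (i <= N n)%N -> (j <= N n)%N ->
    (N n)%:R * `|dev n i j w| <= e}.
Proof.
have h m : {ae P, forall w, \forall n \near \oo, ~ bad (m.+1%:R^-1) n w}.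
  by apply: ae_not_bad; rewrite invr_gt0 ltr0n/= invf_le1 ?ler1n ?ltr0n.
have {}h : {ae P, forall w, forall m, \forall n \near \oo, ~ bad (m.+1%:R^-1) n w}.
  exact: ae_foralln.
move: h; apply: filterS => w hw e e0.
pose m := Num.truncn e^-1.
have me : m.+1%:R^-1 <= e.
  by rewrite -[leRHS]invrK lef_pV2 ?posrE ?invr_gt0 ?ltr0n// ltW// truncnS_gt.
have := hw m; apply: filterS2 (nbhs_infty_gt 0%N) => n /= n0 nbad i j iN jN.
have N0 : (0 < N n)%N by apply: Nn_gt0 => //; case/andP: s_itv => /ltW.
apply: le_trans me; rewrite leNgt; apply/negP => hlt; apply: nbad.
exists (i, j); first by apply/allpairsP; exists (i, j); rewrite !mem_iota/= !add0n !ltnS.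
have n0' : 0 < n%:R :> R by rewrite ltr0n.
rewrite /deviates /=; move: hlt; rewrite /dev; set h' := hits _ _ _ _; set l := law _ _ _ _ _ _ _.
rewrite -ltr_pdivrMl ?ltr0n// [_^-1 * _]mulrC -(ltr_pM2l n0') => /lt_le_trans; apply.
rewrite -[X in X * `|_|]gtr0_norm// -normrM mulrBr mulrCA divff ?gt_eqF// mulr1.
by [].
Qed.

End borel_cantelli_grid.

(** * Bilinear extension and checkerboard kernel *)

Section lipschitz.
Context (R : realType).
Implicit Types (A : R -> R -> R) (S : nat -> nat -> R) (n : nat).

(** The rectangles over [u1, u2] below and above height v have nonnegative mass, and the masses add
    up to u2 - u1. *)
Lemma copula_lip1 A u1 u2 v : is_copula A -> 0 <= u1 <= 1 -> 0 <= u2 <= 1 -> 0 <= v <= 1 ->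
  `|A u1 v - A u2 v| <= `|u1 - u2|.
Proof.
move=> [bA mA].
wlog le12 : u1 u2 / u1 <= u2.
  move=> h h1 h2 hv; have [le12|/ltW le21] := leP u1 u2; first exact: h.
  by rewrite distrC [leRHS]distrC; exact: h.
move=> /andP[u10 u11] /andP[u20 u21] /andP[v0 v1].
have [z1 [_ [e1 _]]] := bA u1 (introT andP (conj u10 u11)).
have [z2 [_ [e2 _]]] := bA u2 (introT andP (conj u20 u21)).
have r1 := mA u1 u2 0 v u10 le12 u21 (lexx 0) v0 v1.
have r2 := mA u1 u2 v 1 u10 le12 u21 v0 v1 (lexx 1).
rewrite z1 z2 in r1; rewrite e1 e2 in r2.
by rewrite distrC [leRHS]distrC !ger0_norm ?subr_ge0//; lra.
Qed.

Lemma copula_lip2 A u v1 v2 : is_copula A -> 0 <= u <= 1 -> 0 <= v1 <= 1 -> 0 <= v2 <= 1 ->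
  `|A u v1 - A u v2| <= `|v1 - v2|.
Proof.
move=> [bA mA] u01 v101 v201; apply: (copula_lip1 (fun x y => A y x) v1 v2 u) => //.
split=> [x /bA[? [? []]]//|u1 u2 w1 w2 a b c d e f].
by have := mA w1 w2 u1 u2 d e f a b c; lra.
Qed.

Lemma copula_lip A u1 u2 v1 v2 : is_copula A -> 0 <= u1 <= 1 -> 0 <= u2 <= 1 ->
  0 <= v1 <= 1 -> 0 <= v2 <= 1 -> `|A u1 v1 - A u2 v2| <= `|u1 - u2| + `|v1 - v2|.
Proof.
move=> cA h1 h2 k1 k2; apply: (le_trans (ler_distD (A u2 v1) _ _)).
by apply: lerD; [exact: copula_lip1|exact: copula_lip2].
Qed.

Lemma grid_lip1 n S a1 a2 b : grid_subcopula n S -> (a1 <= n)%N -> (a2 <= n)%N -> (b <= n)%N ->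
  `|S a1 b - S a2 b| <= `|a1%:R / n%:R - a2%:R / n%:R|.
Proof.
move=> [bS mS].
wlog le12 : a1 a2 / (a1 <= a2)%N.
  move=> h h1 h2 hb; have [le12|/ltnW le21] := leqP a1 a2; first exact: h.
  by rewrite distrC [leRHS]distrC; exact: h.
move=> a1n a2n bn.
have [_ [z1 [_ e1]]] := bS a1 a1n; have [_ [z2 [_ e2]]] := bS a2 a2n.
have r1 : 0 <= S a2 b - S a1 b - S a2 0%N + S a1 0%N.
  by apply: mS; rewrite ?le12 ?leq0n.
have r2 : 0 <= S a2 n - S a1 n - S a2 b + S a1 b.
  by apply: mS; rewrite ?le12 ?bn ?leqnn.
rewrite z1 z2 in r1; rewrite e1 e2 in r2.
have ? : 0 <= a2%:R / n%:R - a1%:R / n%:R :> R.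
  by rewrite -mulrBl divr_ge0// subr_ge0 ler_nat.
by rewrite distrC [leRHS]distrC !ger0_norm//; lra.
Qed.

Lemma grid_lip n S a1 a2 b1 b2 : grid_subcopula n S ->
  (a1 <= n)%N -> (a2 <= n)%N -> (b1 <= n)%N -> (b2 <= n)%N ->
  `|S a1 b1 - S a2 b2| <= `|a1%:R / n%:R - a2%:R / n%:R| + `|b1%:R / n%:R - b2%:R / n%:R|.
Proof.
move=> gS h1 h2 k1 k2; apply: (le_trans (ler_distD (S a2 b1) _ _)).
apply: lerD; first exact: grid_lip1.
apply: (grid_lip1 n (fun i j => S j i) b1 b2 a2) => //.
case: gS => bS mS; split=> [j /bS[? [? []]]//|i1 i2 j1 j2 a b].
by have := mS _ _ _ _ b a; lra.
Qed.

(** Capping the index at n - 1 assigns u = 1 to the last cell. *)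
Lemma grid_cell n (u : R) : (0 < n)%N -> 0 <= u <= 1 ->
  let a := minn (Num.truncn (u * n%:R)) n.-1 in
  [/\ (a < n)%N, a%:R <= u * n%:R & u * n%:R <= a.+1%:R].
Proof.
move=> n0 /andP[u0 u1] a; have un0 : 0 <= u * n%:R by rewrite mulr_ge0.
have an : (a < n)%N by rewrite /a -(ltn_predK n0) /= ltnS geq_minr.
have at' : (a%:R <= (Num.truncn (u * n%:R))%:R :> R) by rewrite ler_nat geq_minl.
split => //; first by apply: (le_trans at'); rewrite truncn_le.
rewrite /a; have [h|h] := leqP (Num.truncn (u * n%:R)) n.-1.
  by rewrite ltW// truncnS_gt.
by rewrite (ltn_predK n0) ler_piMl.
Qed.

(** The interpolated value is a convex combination of four corner values. Each corner lies within
    1/n of (u, v) in both coordinates and [S] is 1-Lipschitz, whence 2/n. *)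
Lemma bilinear_ext_near n S u v p q : (0 < n)%N -> grid_subcopula n S ->
  0 <= u <= 1 -> 0 <= v <= 1 -> (p <= n)%N -> (q <= n)%N ->
  `|bilinear_ext n S u v - S p q|
  <= `|u - p%:R / n%:R| + `|v - q%:R / n%:R| + 2 / n%:R.
Proof.
move=> n0 gS u01 v01 pn qn; rewrite /bilinear_ext.
have [an a1 a2] := grid_cell n u n0 u01; have [bn b1 b2] := grid_cell n v n0 v01.
move: an a1 a2 bn b1 b2; set a := minn _ _; set b := minn _ _ => an a1 a2 bn b1 b2.
set t := _ - a%:R; set r := _ - b%:R.
rewrite -natr1 in a2; rewrite -natr1 in b2.
have [t0 t1] : 0 <= t /\ 0 <= 1 - t by rewrite /t; lra.
have [r0 r1] : 0 <= r /\ 0 <= 1 - r by rewrite /r; lra.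
have n0' : 0 < n%:R :> R by rewrite ltr0n.
set eps := leRHS.
have near a' b' : (a' = a \/ a' = a.+1) -> (b' = b \/ b' = b.+1) -> `|S a' b' - S p q| <= eps.
  move=> ha hb.
  have [a'n ha'] : (a' <= n)%N /\ `|a'%:R / n%:R - u| <= n%:R^-1.
    split; first by case: ha => ->; [exact: ltnW|].
    rewrite -(ler_pM2r n0') mulVf ?gt_eqF// -[X in _ * X](gtr0_norm n0') -normrM.
    rewrite mulrBl divfK ?gt_eqF// ler_norml.
    by case: ha => ->; rewrite -?natr1; apply/andP; split; lra.
  have [b'n hb'] : (b' <= n)%N /\ `|b'%:R / n%:R - v| <= n%:R^-1.
    split; first by case: hb => ->; [exact: ltnW|].
    rewrite -(ler_pM2r n0') mulVf ?gt_eqF// -[X in _ * X](gtr0_norm n0') -normrM.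
    rewrite mulrBl divfK ?gt_eqF// ler_norml.
    by case: hb => ->; rewrite -?natr1; apply/andP; split; lra.
  apply: (le_trans (grid_lip _ _ _ _ _ _ gS a'n pn b'n qn)).
  have := ler_distD u (a'%:R / n%:R) (p%:R / n%:R).
  have := ler_distD v (b'%:R / n%:R) (q%:R / n%:R).
  by rewrite /eps; lra.
have h00 := near a b (or_introl erefl) (or_introl erefl).
have h10 := near a.+1 b (or_intror erefl) (or_introl erefl).
have h01 := near a b.+1 (or_introl erefl) (or_intror erefl).
have h11 := near a.+1 b.+1 (or_intror erefl) (or_intror erefl).
rewrite (_ : _ - S p q = (1 - t) * (1 - r) * (S a b - S p q) + t * (1 - r) * (S a.+1 b - S p q)
  + (1 - t) * r * (S a b.+1 - S p q) + t * r * (S a.+1 b.+1 - S p q)); last by ring.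
rewrite (_ : eps = (1 - t) * (1 - r) * eps + t * (1 - r) * eps + (1 - t) * r * eps + t * r * eps);
  last by ring.
have wle c x : 0 <= c -> `|x| <= eps -> `|c * x| <= c * eps.
  by move=> c0 hx; rewrite normrM ger0_norm// ler_wpM2l.
do 3!(apply: (le_trans (ler_normD _ _)); apply: lerD; last by apply: wle; rewrite ?mulr_ge0).
by apply: wle; rewrite ?mulr_ge0.
Qed.

Lemma bilinear_ext_0 n S u : (0 < n)%N -> grid_subcopula n S ->
  0 <= u <= 1 -> bilinear_ext n S u 0 = 0.
Proof.
move=> n0 [bS _] u01; rewrite /bilinear_ext mul0r truncn0 min0n subr0.
have [an _ _] := grid_cell n u n0 u01; move: an; set a := minn _ _ => an.
have [_ [-> _]] := bS a (ltnW an); have [_ [-> _]] := bS a.+1 an.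
by ring.
Qed.

Lemma bilinear_ext_1 n S u : (0 < n)%N -> grid_subcopula n S ->
  0 <= u <= 1 -> bilinear_ext n S u 1 = u.
Proof.
move=> n0 [bS _] u01; rewrite /bilinear_ext mul1r natrK.
have -> : minn n n.-1 = n.-1 by apply/minn_idPr; exact: leq_pred.
have [an _ _] := grid_cell n u n0 u01; move: an; set a := minn _ _ => an.
rewrite (ltn_predK n0).
have -> : n%:R - n.-1%:R = 1 :> R by rewrite -[in n%:R](ltn_predK n0) -natr1 addrAC subrr add0r.
have [_ [_ [_ ->]]] := bS a (ltnW an); have [_ [_ [_ ->]]] := bS a.+1 an.
rewrite -natr1; have n0' : n%:R != 0 :> R by rewrite pnatr_eq0 -lt0n.
by field.
Qed.

End lipschitz.

Section checkerboard.
Context (R : realType).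

Lemma unit_cell N (u : R) : (0 < N)%N -> 0 <= u <= 1 -> exists i,
  [/\ (i < N)%N, i%:R <= u * N%:R, u * N%:R <= i.+1%:R,
      (forall j, (j < i)%N -> j.+1%:R < u * N%:R) & ((0 < i)%N -> i%:R < u * N%:R)].
Proof.
move=> N0 /andP[u0 u1].
have ex : exists i, u * N%:R <= i.+1%:R.
  by exists N.-1; rewrite (ltn_predK N0) ler_piMl.
have lo j : (j < ex_minn ex)%N -> j.+1%:R < u * N%:R.
  by case: ex_minnP => m _ hm jm; rewrite ltNge; apply/negP => /hm; rewrite leqNgt jm.
have hi : u * N%:R <= (ex_minn ex).+1%:R by case: ex_minnP.
have iN : (ex_minn ex < N)%N.
  case: ex_minnP => m _ hm; rewrite -(ltn_predK N0) ltnS; apply: hm.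
  by rewrite (ltn_predK N0) ler_piMl.
move: (ex_minn ex) lo hi iN => i lo hi iN.
have lo' : (0 < i)%N -> i%:R < u * N%:R.
  by case: i lo {hi iN} => // i lo _; exact: lo.
exists i; split=> //.
by case: i lo' {lo hi iN} => [_|i h]; [rewrite mulr_ge0|exact/ltW/h].
Qed.

(** The weights 1, r, 0 are the values of N [leb_I N j v] when v lies in cell i: cells fully below
    v, the cell reached up to the fraction r, cells above. *)
Lemma sum_unit_cell (f : nat -> R) N i r : (i < N)%N ->
  \sum_(j < N) (f j.+1 - f j) * (if (j < i)%N then 1 else if j == i :> nat then r else 0)
  = (1 - r) * f i + r * f i.+1 - f 0%N.
Proof.
move=> iN; rewrite -(big_mkord xpredT (fun j => (f j.+1 - f j) *
  (if (j < i)%N then 1 else if j == i then r else 0))).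
rewrite (@big_cat_nat _ _ _ i)//=; last exact: ltnW.
rewrite [X in _ + X]big_ltn// ltnn eqxx.
rewrite [X in _ + (_ + X)](_ : _ = 0) ?addr0; last first.
  rewrite big_nat_cond; apply: big1 => j /andP[/andP[ij _] _].
  by rewrite ltnNge (ltnW ij)/= gtn_eqF// mulr0.
rewrite big_nat_cond (eq_bigr (fun j => f j.+1 - f j)); last first.
  by move=> j /andP[/andP[_ ji] _]; rewrite ji mulr1.
rewrite -big_nat_cond telescope_sumr//; ring.
Qed.

(** The row indicator keeps a single row, and one factor N turns the lengths [leb_I] into fractions.
    The term [D 0] stays because [B] is an arbitrary function; it vanishes when [B] is zero on the
    lower edge. *)
Lemma cb_kernelE N (B : R -> R -> R) (u v : R) : (0 < N)%N -> 0 <= u <= 1 -> 0 <= v <= 1 ->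
  exists i j r, let D l := B (i.+1%:R / N%:R) (l%:R / N%:R) - B (i%:R / N%:R) (l%:R / N%:R) in
  [/\ (i < N)%N, (j < N)%N, (0 <= r <= 1) && (v * N%:R == j%:R + r),
      (i%:R <= u * N%:R <= i.+1%:R)
    & cb_kernel N B u v = N%:R * ((1 - r) * D j + r * D j.+1 - D 0%N)].
Proof.
move=> N0 u01 v01.
have [i [iN iu ui lti lti0]] := unit_cell N u N0 u01.
have [j [jN jv vj ltj ltj0]] := unit_cell N v N0 v01.
have N0' : 0 < N%:R :> R by rewrite ltr0n.
exists i, j, (v * N%:R - j%:R); move=> D; split => //.
- by rewrite -natr1 in vj; apply/andP; split; [apply/andP; split; lra|rewrite addrC subrK].
- by rewrite iu ui.
set r := v * N%:R - j%:R.
have indE l : ind_I N l u = (l == i)%:R.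
  move: u01 => /andP[u0 u1]; rewrite /ind_I u0/= ler_pdivlMr// ltr_pdivrMr//.
  rewrite [_ <= l.+1%:R / _]ler_pdivlMr//.
  have [l0|l0] := eqVneq l 0%N.
    rewrite l0; have [i0|i0] := posnP i; first by move: (ui); rewrite i0 => ->.
    by rewrite leNgt (lti 0%N i0) (ltn_eqF i0).
  case: (eqVneq l i); first by move=> li; rewrite li ui lti0// lt0n -li.
  rewrite neq_ltn => /orP[li|il]; first by rewrite [_ <= l.+1%:R]leNgt (lti _ li) andbF.
  by rewrite ltNge (le_trans ui) ?ler_nat.
have lebE l : N%:R * leb_I N l v = if (l < j)%N then 1 else if l == j then r else 0.
  rewrite /leb_I; have [lj|jl|->] := ltngtP l j.
  - rewrite min_r; last by rewrite ler_pdivrMr// ltW// ltj.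
    by rewrite -natr1 mulrDl addrAC subrr add0r max_r ?mul1r ?mulfV ?invr_ge0 ?gt_eqF.
  - have h : v <= l%:R / N%:R by rewrite ler_pdivlMr// (le_trans vj)// ler_nat.
    rewrite min_l; last by rewrite (le_trans h)// ler_pM2r ?invr_gt0// ler_nat.
    by rewrite max_l ?mulr0// subr_le0.
  - rewrite min_l; last by rewrite ler_pdivlMr.
    rewrite max_r; last by rewrite subr_ge0 ler_pdivrMr.
    by rewrite /r; field; rewrite gt_eqF.
rewrite /cb_kernel (bigD1 (Ordinal iN))//= [X in _ + X]big1 ?addr0; last first.
  move=> l li; apply: big1 => m _; rewrite indE.
  by rewrite (_ : (nat_of_ord l == i) = false) ?mulr0 ?mul0r//; apply/negbTE.
rewrite -(sum_unit_cell D N j r jN) expr2 -mulrA !mulr_sumr; apply: eq_bigr => l _.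
rewrite -lebE indE eqxx mulr1 /rect_mass /D; ring.
Qed.

End checkerboard.

(** * Continuous Markov kernels *)

Section kernel.
Context (R : realType) (A k : R -> R -> R).
Context (cA : is_copula A) (kA : continuous_markov_kernel_of A k).

Lemma kernel_cont u v e : 0 <= u <= 1 -> 0 <= v <= 1 -> 0 < e -> exists2 dl, 0 < dl &
  forall u' v', 0 <= u' <= 1 -> 0 <= v' <= 1 -> `|u - u'| < dl -> `|v - v'| < dl ->
    `|k u' v' - k u v| <= e.
Proof.
move=> hu hv e0; case: kA => /subspace_continuousP cont _.
have Auv : [set p : R * R | 0 <= p.1 <= 1 /\ 0 <= p.2 <= 1] (u, v) by [].
have /cvgrPdist_le /(_ e e0) := cont _ Auv.
rewrite near_withinE => /nbhs_ballP[dl /= dl0 h].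
exists dl => // u' v' hu' hv' du dv; rewrite distrC.
by apply: (h (u', v')) => //=; split.
Qed.

Lemma kernel_ge0 u v : 0 <= u <= 1 -> 0 <= v <= 1 -> 0 <= k u v.
Proof.
move=> hu /andP[v0 v1]; case: kA => _ [/(_ u hu)[k0 [_ km]] _].
by apply: (le_trans k0); apply: km.
Qed.

(** By the kernel identity, A u2 v - A u1 v is the integral of k(., v) over ]u1, u2], and the
    integrand stays within e of c there. *)
Lemma kernel_mean u1 u2 v c e : 0 <= u1 -> u1 <= u2 -> u2 <= 1 -> 0 <= v <= 1 ->
  0 <= c -> 0 <= e ->
  (forall t, u1 <= t <= u2 -> `|k t v - c| <= e) ->
  `|A u2 v - A u1 v - c * (u2 - u1)| <= e * (u2 - u1).
Proof.
move=> u10 u12 u21 v01 c0 e0 hk.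
have itvE a b : [set t : R | (a <= t <= b)%R] = `[a, b]%classic.
  by apply/seteqP; split=> t /=; rewrite in_itv.
have mk : measurable_fun (`[0, 1]%classic : set R) (k ^~ v).
  apply: subspace_continuous_measurable_fun => //.
  apply/subspace_continuousP => t /=; rewrite in_itv/= => t01.
  apply/cvgrPdist_le => eps eps0.
  have [dl dl0 h] := kernel_cont t v eps t01 v01 eps0.
  rewrite near_withinE; apply/nbhs_ballP; exists dl => // t' tt'.
  rewrite /= in_itv /= => t'01; rewrite distrC; apply: h => //.
  by rewrite subrr normr0.
have intk := (proj2 (proj2 kA)).
have mI : measurable (`]u1, u2]%classic : set R) by [].
have sub1 t : u1 <= t <= u2 -> 0 <= t <= 1.
  by move=> /andP[a b]; rewrite (le_trans u10 a) (le_trans b u21).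
have mkI : measurable_fun (`]u1, u2]%classic : set R) (EFin \o (k ^~ v)).
  apply/measurable_EFinP; apply: measurable_funS mk => // t /=.
  by rewrite !in_itv/= => /andP[/ltW a b]; apply: sub1; rewrite a b.
pose I := (\int[@lebesgue_measure R]_(t in `]u1, u2]) (k t v)%:E)%E.
have IE : I = (A u2 v - A u1 v)%:E.
  have h2 := intk u2 v (introT andP (conj (le_trans u10 u12) u21)) v01.
  have h1 := intk u1 v (introT andP (conj u10 (le_trans u12 u21))) v01.
  move: h2; rewrite itvE.
  rewrite (@itv_bndbnd_setU _ _ _ (BRight u1)) ?bnd_simp//.
  rewrite integral_setU//=; first last.
  - apply/disj_setPS => t [] /=; rewrite !in_itv/= => /andP[_ a] /andP[b _].
    by have := lt_le_trans b a; rewrite ltxx.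
  - rewrite -itv_bndbnd_setU ?bnd_simp//; apply/measurable_EFinP.
    apply: measurable_funS mk => // t /=; rewrite !in_itv/= => /andP[-> b].
    exact: le_trans u21.
  move: h1; rewrite itvE => -> h2.
  by rewrite EFinB -h2 addeAC subee ?add0e.
have ll : @lebesgue_measure R `]u1, u2]%classic = (u2 - u1)%:E.
  rewrite lebesgue_measure_itv/= lte_fin; case: ifPn => [_|]; first by rewrite EFinB.
  rewrite -leNgt => u21'; have -> : u1 = u2 by apply/eqP; rewrite eq_le u12.
  by rewrite subrr.
have cst_int r : (\int[@lebesgue_measure R]_(t in `]u1, u2]) r%:E)%E = (r * (u2 - u1))%:E.
  by rewrite integral_cst// EFinM; congr (_ * _)%E; exact: ll.
have k0 t : (`]u1, u2]%classic : set R) t -> (0 <= (k t v)%:E)%E.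
  rewrite /= in_itv/= lee_fin => /andP[/ltW a b]; apply: kernel_ge0 => //.
  by apply: sub1; rewrite a b.
have hk' t : (`]u1, u2]%classic : set R) t -> `|k t v - c| <= e.
  by rewrite /= in_itv/= => /andP[/ltW a b]; apply: hk; rewrite a b.
have up : (I <= ((c + e) * (u2 - u1))%:E)%E.
  rewrite -cst_int; apply: ge0_le_integral => //.
  move=> t /hk'; rewrite ler_norml lee_fin => /andP[_]; lra.
(* The error is added to the kernel side instead of using c - e, which may be negative, so that
   comparison of nonnegative integrals applies. *)
have lo : ((c * (u2 - u1))%:E <= I + (e * (u2 - u1))%:E)%E.
  rewrite -!cst_int /I -ge0_integralD//.
  apply: ge0_le_integral => //.
    by apply: emeasurable_funD.
  move=> t /hk'; rewrite ler_norml lee_fin => /andP[]; lra.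
move: up lo; rewrite IE !lee_fin => up lo.
by rewrite ler_norml; apply/andP; split; lra.
Qed.

(** The identity makes the integrals of k(., 0) vanish, but a positive value at u would persist
    nearby by continuity. [kernel_mean] with c = k u 0 and error c/2 gives the contradiction. It is
    used to show that K(y) drops below [tau]. *)
Lemma kernel_at0 u : 0 <= u <= 1 -> k u 0 = 0.
Proof.
move=> u01; have z01 : 0 <= (0 : R) <= 1 by rewrite lexx ler01.
have k0 := kernel_ge0 u 0 u01 z01.
apply/eqP; rewrite eq_le k0 andbT leNgt; apply/negP => kp.
have [dl dl0 h] := kernel_cont u 0 (k u 0 / 2) u01 z01 (divr_gt0 kp (ltr0Sn _ 1)).
have A0 w : 0 <= w <= 1 -> A w 0 = 0 by move=> /(cA.1)[].
(* The interval extends from u to the side with room in [0, 1]: right if u <= 1/2, left otherwise.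
   Its length, at most 1/2, keeps it inside. *)
have [u1 [u2 [u10 u12 u21 near]]] : exists u1 u2, [/\ 0 <= u1, u1 < u2, u2 <= 1 &
    forall t, u1 <= t <= u2 -> `|u - t| < dl].
  move: u01 => /andP[u0 u1].
  have [u2|u2] := leP u (1 / 2).
    exists u, (u + Num.min (dl / 2) (1 / 2)).
    have m0 : 0 < Num.min (dl / 2) (1 / 2) by rewrite lt_min; apply/andP; split; lra.
    have m1 : Num.min (dl / 2) (1 / 2) <= 1 / 2 by rewrite ge_min lexx orbT.
    have m2 : Num.min (dl / 2) (1 / 2) <= dl / 2 by rewrite ge_min lexx.
    split; [lra|lra|lra|move=> t /andP[a b]].
    by rewrite distrC ger0_norm; lra.
  exists (u - Num.min (dl / 2) (1 / 2)), u.
  have m0 : 0 < Num.min (dl / 2) (1 / 2) by rewrite lt_min; apply/andP; split; lra.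
  have m1 : Num.min (dl / 2) (1 / 2) <= 1 / 2 by rewrite ge_min lexx orbT.
  have m2 : Num.min (dl / 2) (1 / 2) <= dl / 2 by rewrite ge_min lexx.
  split; [lra|lra|lra|move=> t /andP[a b]].
  by rewrite ger0_norm; lra.
have := @kernel_mean u1 u2 0 (k u 0) (k u 0 / 2) u10 (ltW u12) u21 z01 k0.
rewrite !A0; [|lra|lra].
have k2 : 0 <= k u 0 / 2 by lra.
have nk t : u1 <= t <= u2 -> `|k t 0 - k u 0| <= k u 0 / 2.
  move=> ht; apply: h => //; [|exact: near|by rewrite subrr normr0].
  by move: ht => /andP[a b]; rewrite (le_trans u10 a) (le_trans b u21).
move=> /(_ k2 nk); rewrite subrr sub0r normrN ger0_norm; last first.
  by rewrite mulr_ge0// subr_ge0 ltW.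
have : 0 < k u 0 * (u2 - u1) by rewrite mulr_gt0// subr_gt0.
lra.
Qed.

End kernel.

(** * Convergence of checkerboard kernels and control of the excess *)

Section checkerboard_kernel.
Context (R : realType).

(** The path runs from the interpolation at (u, v) to S p q, then to A a b, then to A u v. In use, p
    and q are counts at quantile points and a, b the values of F and G there. The gaps a - u and b -
    v are paid twice, once for the interpolation and once for A. *)
Lemma bilinear_ext_copula_near (A : R -> R -> R) n S p q (a b u v : R) :
  is_copula A -> (0 < n)%N -> grid_subcopula n S -> (p <= n)%N -> (q <= n)%N ->
  0 <= a <= 1 -> 0 <= b <= 1 -> 0 <= u <= 1 -> 0 <= v <= 1 ->
  `|bilinear_ext n S u v - A u v| <= `|S p q - A a b| + `|p%:R / n%:R - a|
    + `|q%:R / n%:R - b| + 2 * `|a - u| + 2 * `|b - v| + 2 / n%:R.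
Proof.
move=> cA n0 gS pn qn a01 b01 u01 v01.
have h1 := bilinear_ext_near R n S u v p q n0 gS u01 v01 pn qn.
have h2 := copula_lip R A a u b v cA a01 u01 b01 v01.
have h3 := ler_distD a u (p%:R / n%:R); have h4 := ler_distD b v (q%:R / n%:R).
have h5 := ler_distD (S p q) (bilinear_ext n S u v) (A u v).
have h6 := ler_distD (A a b) (S p q) (A u v).
rewrite (distrC u a) (distrC a (_ / _)) in h3.
rewrite (distrC v b) (distrC b (_ / _)) in h4.
lra.
Qed.

Lemma divr_grid01 i N : (i <= N)%N -> 0 <= (i%:R : R) / N%:R <= 1.
Proof.
move=> iN; have [->|N0] := posnP N; first by rewrite invr0 mulr0 lexx ler01.
by rewrite divr_ge0//= ler_pdivrMr ?ltr0n// mul1r ler_nat.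
Qed.

Lemma cb_kernel_0 N (B : R -> R -> R) u : (0 < N)%N -> 0 <= u <= 1 -> cb_kernel N B u 0 = 0.
Proof.
move=> N0 u01; have z01 : 0 <= (0 : R) <= 1 by rewrite lexx ler01.
have [i [j [r [iN jN /andP[/andP[r0 r1] /eqP]]]]] := cb_kernelE R N B u 0 N0 u01 z01.
rewrite mul0r => jr _ ->.
have j0 : j = 0%N.
  by apply/eqP; rewrite -(pnatr_eq0 R) eq_le ler0n andbT; lra.
have -> : r = 0 by move: jr; rewrite j0 add0r.
by rewrite j0; ring.
Qed.

Lemma cb_kernel_1 N (B : R -> R -> R) u : (0 < N)%N -> 0 <= u <= 1 ->
  (forall t, 0 <= t <= 1 -> B t 0 = 0 /\ B t 1 = t) -> cb_kernel N B u 1 = 1.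
Proof.
move=> N0 u01 hB; have z01 : 0 <= (1 : R) <= 1 by rewrite lexx ler01.
have [i [j [r [iN jN /andP[/andP[r0 r1] /eqP]]]]] := cb_kernelE R N B u 1 N0 u01 z01.
rewrite mul1r => jr _ ->.
have jN' : j.+1 = N.
  apply/eqP; rewrite eqn_leq jN/= -(ler_nat R) -natr1; lra.
have -> : r = 1 by move: jr; rewrite -jN' -natr1; lra.
have [i1 i2] := hB _ (divr_grid01 _ _ (ltnW iN)).
have [i3 i4] := hB _ (divr_grid01 _ _ iN).
have N0' : N%:R != 0 :> R by rewrite pnatr_eq0 -lt0n.
rewrite jN' mulfV// mul0r i1 i2 i3 i4 -natr1; field.
exact: N0'.
Qed.

(** Each of the two increments of [B] differs from that of A by two grid errors, worth e each after
    multiplication by N; the oscillation of [k] near (u0, v0) gives the third e. A convex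
    combination keeps the bound. *)
Lemma cb_kernel_near (A k : R -> R -> R) (u0 v0 e : R) :
  is_copula A -> continuous_markov_kernel_of A k -> 0 <= u0 <= 1 -> 0 <= v0 <= 1 -> 0 < e ->
  exists2 dl, 0 < dl & forall N (B : R -> R -> R) u v, (0 < N)%N -> N%:R^-1 < dl ->
    0 <= u <= 1 -> 0 <= v <= 1 -> `|u - u0| < dl -> `|v - v0| < dl ->
    (forall t, 0 <= t <= 1 -> B t 0 = 0) ->
    (forall i j, (i <= N)%N -> (j <= N)%N ->
       N%:R * `|B (i%:R / N%:R) (j%:R / N%:R) - A (i%:R / N%:R) (j%:R / N%:R)| <= e) ->
    `|cb_kernel N B u v - k u0 v0| <= 3 * e.
Proof.
move=> cA kA u01 v01 e0.
have [dl dl0 hdl] := kernel_cont R A k kA u0 v0 e u01 v01 e0.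
(* Half of dl covers the distance from (u, v) to (u0, v0), the other half the cell width 1/N. *)
exists (dl / 2); first by rewrite divr_gt0.
move=> N B u v N0 Ndl hu hv du dv B0 hB.
have N0' : 0 < N%:R :> R by rewrite ltr0n.
have [i [j [r [iN jN /andP[r01 /eqP vN] uN ->]]]] := cb_kernelE R N B u v N0 hu hv.
rewrite !mul0r !B0 ?divr_grid01// 1?ltnW// subr0 subr0.
have r0 : 0 <= r by case/andP: r01.
have r1 : 0 <= 1 - r by case/andP: r01; lra.
have Dl l : (l <= N)%N -> `|v - l%:R / N%:R| <= N%:R^-1 ->
  `|N%:R * (B (i.+1%:R / N%:R) (l%:R / N%:R) - B (i%:R / N%:R) (l%:R / N%:R)) - k u0 v0|
   <= 3 * e.
  move=> lN vl.
  have ii : i.+1%:R / N%:R - i%:R / N%:R = N%:R^-1 :> R.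
    by rewrite -mulrBl -natr1 addrAC subrr add0r mul1r.
  have [a0 a1] := andP (divr_grid01 _ _ (ltnW iN)).
  have [b0 b1] := andP (divr_grid01 _ _ iN).
  have N1 : 0 < N%:R^-1 :> R by rewrite invr_gt0.
  have ab : i%:R / N%:R <= i.+1%:R / N%:R :> R by lra.
  have l01 := divr_grid01 _ _ lN.
  have uN1 : i%:R / N%:R <= u by rewrite ler_pdivrMr//; case/andP: uN.
  have uN2 : u <= i.+1%:R / N%:R by rewrite ler_pdivlMr//; case/andP: uN.
  have hyp t : i%:R / N%:R <= t <= i.+1%:R / N%:R ->
      `|k t (l%:R / N%:R) - k u0 v0| <= e.
    move=> /andP[t1 t2]; apply: hdl => //.
    - by rewrite (le_trans a0 t1) (le_trans t2 b1).
    - have := ler_distD u u0 t; rewrite (distrC u0 u).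
      have : `|u - t| <= N%:R^-1 by rewrite ler_norml; lra.
      lra.
    - by have := ler_distD v v0 (l%:R / N%:R); rewrite (distrC v0 v); lra.
  have := kernel_mean R A k kA _ _ (l%:R / N%:R) (k u0 v0) e a0 ab b1 l01
    (kernel_ge0 R A k kA u0 v0 u01 v01) (ltW e0) hyp.
  rewrite ii; set DA := A _ _ - A _ _ => hA.
  have hA' : `|N%:R * DA - k u0 v0| <= e.
    rewrite (_ : _ - _ = N%:R * (DA - k u0 v0 * N%:R^-1)); last by field; rewrite gt_eqF.
    by rewrite normrM gtr0_norm// mulrC -ler_pdivlMr.
  have h1 := hB i.+1 l iN lN; have h0 := hB i l (ltnW iN) lN.
  rewrite -[X in X * _](gtr0_norm N0') -normrM in h1.
  rewrite -[X in X * _](gtr0_norm N0') -normrM in h0.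
  move: hA' h1 h0; rewrite !ler_norml /DA !mulrBr => /andP[? ?] /andP[? ?] /andP[? ?].
  by apply/andP; split; lra.
have vN' : v = j%:R / N%:R + r / N%:R by rewrite -mulrDl -vN mulfK// gt_eqF.
have N1 : 0 < N%:R^-1 :> R by rewrite invr_gt0.
have rN0 : 0 <= r / N%:R by rewrite divr_ge0// ltW.
have rN1 : r / N%:R <= N%:R^-1 by rewrite ler_piMl ?(ltW N1)//; lra.
have h1 : `|N%:R * (B (i.+1%:R / N%:R) (j%:R / N%:R) - B (i%:R / N%:R) (j%:R / N%:R)) - k u0 v0|
   <= 3 * e.
  by apply: Dl; [exact: ltnW|rewrite vN' ler_norml; apply/andP; split; lra].
have h2 : `|N%:R * (B (i.+1%:R / N%:R) (j.+1%:R / N%:R) - B (i%:R / N%:R) (j.+1%:R / N%:R))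
    - k u0 v0|
   <= 3 * e.
  apply: Dl; first exact: jN.
  by rewrite vN' -natr1 mulrDl mul1r ler_norml; apply/andP; split; lra.
move: h1 h2; set D1 := B _ _ - B _ _; set D2 := B _ _ - B _ _ => h1 h2.
rewrite (_ : _ - k u0 v0 =
  (1 - r) * (N%:R * D1 - k u0 v0) + r * (N%:R * D2 - k u0 v0)); last by ring.
rewrite (_ : 3 * e = (1 - r) * (3 * e) + r * (3 * e)); last by ring.
by apply: (le_trans (ler_normD _ _)); apply: lerD; rewrite normrM ger0_norm// ler_wpM2l.
Qed.

Lemma excess_le (a b c d e : R) : c <= d -> 0 <= e -> c - e <= a -> b <= d + e ->
  0 <= excess a b c d <= e.
Proof.
move=> cd e0 ca bd; rewrite /excess.
set I := fun yn => inf [set `|yn - y| | y in [set y | c <= y <= d]].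
have lb yn : has_lbound [set `|yn - y| | y in [set y | c <= y <= d]].
  by exists 0 => _ [y _ <-].
have I0 yn : 0 <= I yn.
  by apply: lb_le_inf; [exists `|yn - c|, c; rewrite //= lexx cd | move=> _ [y _ <-]].
have Ie yn : a <= yn <= b -> I yn <= e.
  move=> /andP[ay yb].
  have [y [cy yd ye]] : exists y, [/\ c <= y, y <= d & `|yn - y| <= e].
    have [h|h] := leP yn c.
      by exists c; split=> //; rewrite ler_norml; lra.
    have [h'|h'] := leP yn d; first by exists yn; split; [exact: ltW| |rewrite subrr normr0].
    by exists d; split=> //; rewrite ler_norml; lra.
  by apply: le_trans ye; apply: ge_inf => //; exists y => //=; rewrite cy yd.
(* The interval [a, b] may be empty, in which case [sup] is 0 by convention. *)
have [->|/set0P[z zS]] := eqVneq [set I yn | yn in [set yn | a <= yn <= b]] set0.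
  by rewrite sup0 lexx.
have ub : has_ubound [set I yn | yn in [set yn | a <= yn <= b]].
  by exists e => _ [yn h <-]; exact: Ie.
apply/andP; split; last by apply: ge_sup; [exists z|move=> _ [yn h <-]; exact: Ie].
apply: (@le_trans _ _ z); last exact: ub_le_sup.
by case: zS => yn _ <-.
Qed.

End checkerboard_kernel.

(** * Distribution functions *)

Section cdf.
Context (R : realType) (d : measure_display) (T : measurableType d) (P : probability T R).

Lemma measurable_le_const (X : T -> R) x : measurable_fun setT X -> measurable [set w | X w <= x].
Proof.
move=> mX; rewrite (_ : [set w | _] = [set: T] `&` X @^-1` `]-oo, x]%classic).
  exact: mX.
by rewrite setTI; apply/seteqP; split=> w /=; rewrite in_itv.
Qed.

Lemma distr_fun01 (X : T -> R) x : measurable_fun setT X -> 0 <= distr_fun P X x <= 1.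
Proof.
move=> mX; have mX' := measurable_le_const X x mX.
rewrite /distr_fun fine_ge0 ?measure_ge0//= -lee_fin fineK ?probability_le1//.
by rewrite fin_num_measure.
Qed.

Lemma distr_fun_homo (X : T -> R) : measurable_fun setT X ->
  {homo distr_fun P X : x y / x <= y}.
Proof.
move=> mX x y xy; have mx := measurable_le_const X x mX; have my := measurable_le_const X y mX.
rewrite /distr_fun fine_le ?fin_num_measure//.
by rewrite le_measure ?inE// => w /= /le_trans; apply.
Qed.

Lemma distr_fun_hi (X : T -> R) e : measurable_fun setT X -> 0 < e ->
  exists x, 1 - e < distr_fun P X x.
Proof.
move=> mX e0.
pose X' : {mfun T >-> R} := HB.pack X (@isMeasurableFun.Build _ _ _ _ X mX).
have : @cdf _ _ _ P X' @ +oo%R --> 1%:E by exact: cvg_cdfy1.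
have XE x : @cdf _ _ _ P X' x = (distr_fun P X x)%:E.
  by rewrite /distr_fun fineK ?fin_num_measure//; exact: measurable_le_const.
rewrite (_ : @cdf _ _ _ P X' = EFin \o distr_fun P X); last exact/funext.
move/fine_cvgP => [_ /cvgrPdist_lt/(_ e e0) h].
have [x hx] : exists x, `|1 - distr_fun P X x| < e.
  by have [x hx] := @filter_ex _ (@pinfty_nbhs R) _ _ h; exists x.
by exists x; move: hx; rewrite ltr_norml => /andP[]; lra.
Qed.

Lemma distr_fun_lo (X : T -> R) e : measurable_fun setT X -> 0 < e ->
  exists x, distr_fun P X x < e.
Proof.
move=> mX e0.
pose X' : {mfun T >-> R} := HB.pack X (@isMeasurableFun.Build _ _ _ _ X mX).
have : @cdf _ _ _ P X' @ -oo%R --> 0%:E by exact: cvg_cdfNy0.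
have XE x : @cdf _ _ _ P X' x = (distr_fun P X x)%:E.
  by rewrite /distr_fun fineK ?fin_num_measure//; exact: measurable_le_const.
rewrite (_ : @cdf _ _ _ P X' = EFin \o distr_fun P X); last exact/funext.
move/fine_cvgP => [_ /cvgrPdist_lt/(_ e e0) h].
have [x hx] : exists x, `|0 - distr_fun P X x| < e.
  by have [x hx] := @filter_ex _ (@ninfty_nbhs R) _ _ h; exists x.
by exists x; move: hx; rewrite ltr_norml => /andP[]; lra.
Qed.

Lemma joint_cdf_near (X Y : T -> R) x y : measurable_fun setT X -> measurable_fun setT Y ->
  joint_cdf P X Y x y <= distr_fun P X x <= joint_cdf P X Y x y + (1 - distr_fun P Y y).
Proof.
move=> mX mY.
have mx := measurable_le_const X x mX; have my := measurable_le_const Y y mY.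
have mxy : measurable [set w | X w <= x /\ Y w <= y].
  by rewrite (_ : [set w | _] = [set w | X w <= x] `&` [set w | Y w <= y])//; exact: measurableI.
have f1 := fin_num_measure P _ mx; have f2 := fin_num_measure P _ my.
have f3 := fin_num_measure P _ mxy.
rewrite /joint_cdf /distr_fun; apply/andP; split.
  by rewrite fine_le// le_measure ?inE// => w [].
rewrite -lee_fin EFinD EFinB !fineK// -probability_setC//.
apply: le_trans; last apply: measureU2 => //; last exact: measurableC.
apply: le_measure; rewrite ?inE//; first by apply: measurableU => //; exact: measurableC.
by move=> w /= xw; have [yw|yw] := pselect (Y w <= y); [left|right].
Qed.

(** Continuity is given for the joint distribution function. For y with G(y) close to 1 its section
    at y is uniformly close to F, so the intermediate value theorem for that section yields a point
    where F is close to p. *)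
Lemma quantile_near (X Y : T -> R) p e : measurable_fun setT X -> measurable_fun setT Y ->
  (forall y, continuous (fun x => joint_cdf P X Y x y)) -> 0 <= p <= 1 -> 0 < e ->
  exists x, `|distr_fun P X x - p| <= e.
Proof.
move=> mX mY cH /andP[p0 p1] e0; have e3 : 0 < e / 3 by lra.
have [y hy] := distr_fun_hi Y _ mY e3.
have [x1 h1] := distr_fun_hi X _ mX e3.
have [x0' h0'] := distr_fun_lo X _ mX e3.
have [x0 [x01 h0]] : exists x0, x0 <= x1 /\ distr_fun P X x0 < e / 3.
  exists (Num.min x0' x1); split; first by rewrite ge_min lexx orbT.
  apply: le_lt_trans h0'; apply: distr_fun_homo => //.
  by rewrite ge_min lexx.
have near x := joint_cdf_near X Y x y mX mY.
have [n1 n2] := andP (near x0); have [n3 n4] := andP (near x1).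
have [l0 l1] := andP (distr_fun01 X x0 mX); have [l2 l3] := andP (distr_fun01 X x1 mX).
(* Levels near 0 or 1 may not be attained by the section; there the endpoints x0 and x1 already
   serve. *)
have [c1|c1] := leP p (e / 3).
  by exists x0; rewrite ler_norml; lra.
have [c2|c2] := leP (1 - 2 * e / 3) p.
  by exists x1; rewrite ler_norml; lra.
have [x xin hx] : exists2 x, x \in `[x0, x1] & joint_cdf P X Y x y = p.
  apply: IVT => //; first exact: continuous_subspaceT.
  have f01 : joint_cdf P X Y x0 y <= joint_cdf P X Y x1 y by lra.
  by rewrite min_l// max_r//; lra.
by exists x; have [m1 m2] := andP (near x); rewrite hx in m1 m2; rewrite ler_norml; lra.
Qed.

End cdf.

(** * Consistency of the quantile intervals *)

Section quantiles.
Context (R : realType) (tau : R) (Kn : nat -> R -> R) (K : R -> R).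
Context (tau01 : 0 < tau < 1) (K_homo : {homo K : x y / x <= y}).
Context (K_lo : exists y, K y < tau) (K_hi : exists y, tau < K y).

Let c := qlow tau K.
Let d := qup tau K.

Let hs : has_sup [set y | K y < tau].
Proof.
split; first by case: K_lo => y h; exists y.
case: K_hi => z hz; exists z => y /= hy; rewrite leNgt; apply/negP => /ltW/K_homo.
by rewrite leNgt (lt_trans hy hz).
Qed.

Let hi : has_inf [set y | tau < K y].
Proof.
split; first by case: K_hi => y h; exists y.
case: K_lo => z hz; exists z => y /= hy; rewrite leNgt; apply/negP => /ltW/K_homo.
by rewrite leNgt (lt_trans hz hy).
Qed.

Lemma qlow_le_qup : c <= d.
Proof.
apply: ge_sup; first exact: hs.1.
move=> y /= hy; apply: lb_le_inf; first exact: hi.1.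
move=> z /= hz; rewrite leNgt; apply/negP => /ltW/K_homo.
by rewrite leNgt (lt_trans hy hz).
Qed.

Lemma below_qlow e : 0 < e -> K (c - e) < tau.
Proof.
by move=> e0; have [y /= hy /ltW/K_homo] := sup_adherent e0 hs; move/le_lt_trans; apply.
Qed.

Lemma above_qup e : 0 < e -> tau < K (d + e).
Proof.
by move=> e0; have [y /= hy /ltW/K_homo] := inf_adherent e0 hi; move/(lt_le_trans _); apply.
Qed.

(** Convergence just below c puts that point into the set whose supremum is the empirical lower
    quantile, and symmetrically above d. The first premise bounds both empirical sets, so that [sup]
    and [inf] are not default values. *)
Lemma excess_cvg0 :
  (\forall n \near \oo, exists M, forall y, (M <= y -> Kn n y = 1) /\ (y < - M -> Kn n y = 0)) ->
  (forall m e, 0 < e -> \forall n \near \oo,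
     `|Kn n (c - m.+1%:R^-1) - K (c - m.+1%:R^-1)| < e) ->
  (forall m e, 0 < e -> \forall n \near \oo,
     `|Kn n (d + m.+1%:R^-1) - K (d + m.+1%:R^-1)| < e) ->
  excess (qlow tau (Kn n)) (qup tau (Kn n)) c d @[n --> \oo] --> (0 : R).
Proof.
move=> hM hc hd; apply/cvgrPdist_le => e e0; case/andP: tau01 => t0 t1.
pose m := Num.truncn e^-1.
have m0 : 0 < m.+1%:R^-1 :> R by rewrite invr_gt0 ltr0n.
have me : m.+1%:R^-1 <= e.
  by rewrite -[leRHS]invrK lef_pV2 ?posrE ?invr_gt0 ?ltr0n// ltW// truncnS_gt.
have gc : 0 < tau - K (c - m.+1%:R^-1) by rewrite subr_gt0 below_qlow.
have gd : 0 < K (d + m.+1%:R^-1) - tau by rewrite subr_gt0 above_qup.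
have := hd m _ gd; have := hc m _ gc.
apply: filterS3 hM => n [M hM] nc nd.
have lo : c - m.+1%:R^-1 <= qlow tau (Kn n).
  apply: ub_le_sup; last by move: nc; rewrite /= ltr_norml => /andP[_]; lra.
  exists M => y /= hy; rewrite leNgt; apply/negP => /ltW /(proj1 (hM y)) E.
  by move: hy; rewrite E; lra.
have up : qup tau (Kn n) <= d + m.+1%:R^-1.
  apply: ge_inf; last by move: nd; rewrite /= ltr_norml => /andP[]; lra.
  exists (- M) => y /= hy; rewrite leNgt; apply/negP => /(proj2 (hM y)) E.
  by move: hy; rewrite E; lra.
have /andP[x0 x1] := excess_le R _ _ c d e qlow_le_qup (ltW e0)
   (le_trans (lerB (lexx c) me) lo) (le_trans up (lerD (lexx d) me)).
by rewrite sub0r normrN ger0_norm.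
Qed.

End quantiles.

(** * Almost sure convergence along the sample *)

Section sample.
Context (R : realType) (d : measure_display) (T : measurableType d)
  (P : probability T R) (X Y : T -> R) (Xs Ys : nat -> T -> R)
  (mX : measurable_fun setT X) (mY : measurable_fun setT Y)
  (mXs : forall i, measurable_fun setT (Xs i))
  (mYs : forall i, measurable_fun setT (Ys i))
  (hiid : iid_sample P X Y Xs Ys)
  (s : R) (s_itv : 0 < s < 1 / 2).

Let F := distr_fun P X.
Let G := distr_fun P Y.
Let H := joint_cdf P X Y.
Let N n := Nn s n.

Let mL x : measurable [set p : R * R | p.1 <= x].
Proof. exact: (measurable_le_const _ _ _ _ _ measurable_fst). Qed.

Let mD y : measurable [set p : R * R | p.2 <= y].
Proof. exact: (measurable_le_const _ _ _ _ _ measurable_snd). Qed.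

Let hitsX n w x :
  hits (fun i w => (Xs i w, Ys i w)) [set p : R * R | p.1 <= x] n w = emp_count Xs n w x.
Proof. by apply: eq_bigr => i _; rewrite /= asboolb. Qed.

Let hitsY n w y :
  hits (fun i w => (Xs i w, Ys i w)) [set p : R * R | p.2 <= y] n w = emp_count Ys n w y.
Proof. by apply: eq_bigr => i _; rewrite /= asboolb. Qed.

Let hitsXY n w x y :
  (hits (fun i w => (Xs i w, Ys i w)) [set p : R * R | p.1 <= x /\ p.2 <= y] n w)%:R / n%:R
  = emp_joint_cdf Xs Ys n w x y :> R.
Proof.
rewrite /emp_joint_cdf; congr (_%:R / _); apply: eq_bigr => i _.
by rewrite /= asbool_and !asboolb.
Qed.

Lemma ae_emp_cdfX (x : nat -> nat -> R) : {ae P, forall w, forall e, 0 < e ->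
  \forall n \near \oo, forall i, (i <= N n)%N ->
    (N n)%:R * `|emp_cdf Xs n w (x n i) - F (x n i)| <= e}.
Proof.
have := ae_deviation_small R d T P X Y Xs Ys mX mY mXs mYs hiid s s_itv
  (fun n i j => [set p : R * R | p.1 <= x n i]) (fun n i j => mL _).
apply: filterS => w h e /h; apply: filterS => n hn i iN.
(* The family does not depend on its column index, so any column will do. *)
by have := hn i 0%N iN (leq0n _); rewrite hitsX.
Qed.

Lemma ae_emp_cdfY (y : nat -> nat -> R) : {ae P, forall w, forall e, 0 < e ->
  \forall n \near \oo, forall i, (i <= N n)%N ->
    (N n)%:R * `|emp_cdf Ys n w (y n i) - G (y n i)| <= e}.
Proof.
have := ae_deviation_small R d T P X Y Xs Ys mX mY mXs mYs hiid s s_itv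
  (fun n i j => [set p : R * R | p.2 <= y n i]) (fun n i j => mD _).
apply: filterS => w h e /h; apply: filterS => n hn i iN.
by have := hn i 0%N iN (leq0n _); rewrite hitsY.
Qed.

Lemma ae_emp_joint_cdf (x y : nat -> nat -> R) : {ae P, forall w, forall e, 0 < e ->
  \forall n \near \oo, forall i j, (i <= N n)%N -> (j <= N n)%N ->
    (N n)%:R * `|emp_joint_cdf Xs Ys n w (x n i) (y n j) - H (x n i) (y n j)| <= e}.
Proof.
have mB n i j : measurable [set p : R * R | p.1 <= x n i /\ p.2 <= y n j].
  exact: (measurableI _ _ (mL _) (mD _)).
have := ae_deviation_small R d T P X Y Xs Ys mX mY mXs mYs hiid s s_itv _ mB.
apply: filterS => w h e /h; apply: filterS => n hn i j iN jN.
by have := hn i j iN jN; rewrite hitsXY.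
Qed.

Lemma emp_count_le (Z : nat -> T -> R) n w z : (emp_count Z n w z <= n)%N.
Proof.
rewrite /emp_count -[leqRHS](card_ord n) -sum1_card; apply: leq_sum => i _.
by case: (Z i w <= z).
Qed.

Context (A : R -> R -> R) (cA : is_copula A) (AH : forall x y, H x y = A (F x) (G y)).
Context (cH : continuous (fun p : R * R => H p.1 p.2)).
Context (S : nat -> T -> nat -> nat -> R) (hS : empirical_subcopula P Xs Ys S).

(** The tolerance 1/(n+1) is o(1/N) and is positive even at n = 0. *)
Let x_quantile : exists x : nat -> nat -> R, forall n i, (i <= N n)%N ->
  `|F (x n i) - i%:R / (N n)%:R| <= n.+1%:R^-1.
Proof.
have h n : exists x, forall i, (i <= N n)%N -> `|F (x i) - i%:R / (N n)%:R| <= n.+1%:R^-1.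
  suff : forall i, exists x, (i <= N n)%N -> `|F x - i%:R / (N n)%:R| <= n.+1%:R^-1.
    by move=> /boolp.choice[f fP]; exists f.
  move=> i; have [iN|] := leqP i (N n); last by exists 0.
  have [|||x hx] := quantile_near R d T P X Y (i%:R / (N n)%:R) n.+1%:R^-1 mX mY.
  - by move=> y x; exact: (cvg_comp2 cvg_id (cvg_cst y) (cH (x, y))).
  - exact: divr_grid01.
  - by rewrite invr_gt0.
  by exists x.
by have [f fP] := boolp.choice h; exists f.
Qed.

Let y_quantile : exists y : nat -> nat -> R, forall n i, (i <= N n)%N ->
  `|G (y n i) - i%:R / (N n)%:R| <= n.+1%:R^-1.
Proof.
have h n : exists y, forall i, (i <= N n)%N -> `|G (y i) - i%:R / (N n)%:R| <= n.+1%:R^-1.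
  suff : forall i, exists y, (i <= N n)%N -> `|G y - i%:R / (N n)%:R| <= n.+1%:R^-1.
    by move=> /boolp.choice[f fP]; exists f.
  move=> i; have [iN|] := leqP i (N n); last by exists 0.
  have [|||y hy] := quantile_near R d T P Y X (i%:R / (N n)%:R) n.+1%:R^-1 mY mX.
  - move=> x y; have -> : (fun y => joint_cdf P Y X y x) = (fun y => H x y).
      apply/funext => z; rewrite /H /joint_cdf; congr (fine (P _)).
      by apply/seteqP; split=> w /= [].
    exact: (cvg_comp2 (cvg_cst x) cvg_id (cH (x, y))).
  - exact: divr_grid01.
  - by rewrite invr_gt0.
  by exists y.
by have [f fP] := boolp.choice h; exists f.
Qed.

Let ae_and (Q1 Q2 : T -> Prop) : {ae P, forall w, Q1 w} -> {ae P, forall w, Q2 w} ->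
  {ae P, forall w, Q1 w /\ Q2 w}.
Proof. by move=> h1 h2; apply: filterI. Qed.

Lemma ae_empirical_copula_near : {ae P, forall w, forall e, 0 < e ->
  \forall n \near \oo, forall i j, (i <= N n)%N -> (j <= N n)%N ->
    (N n)%:R * `|bilinear_ext n (S n w) (i%:R / (N n)%:R) (j%:R / (N n)%:R)
                 - A (i%:R / (N n)%:R) (j%:R / (N n)%:R)| <= e}.
Proof.
have [x hx] := x_quantile; have [y hy] := y_quantile.
have := ae_and _ _ (ae_and _ _ (ae_emp_cdfX x) (ae_emp_cdfY y))
  (ae_and _ _ hS (ae_emp_joint_cdf x y)).
apply: filterS => w [[aX aY] [hw aXY]] e e0.
(* Budget: three empirical deviations at e/6, and six terms at e/12, namely two for each quantile
   gap and two for the interpolation. *)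
have e6 : 0 < e / 6 by lra. have e12 : 0 < e / 12 by lra.
have hN := Nn_littleo R s (e / 12) s_itv e12.
near=> n; move=> i j iN jN.
have n0 : (0 < n)%N by near: n; exact: (nbhs_infty_gt 0%N).
have [gS hJ] := hw n n0.
have hX : (N n)%:R * `|emp_cdf Xs n w (x n i) - F (x n i)| <= e / 6.
  by move: i iN {j jN}; near: n; exact: aX.
have hY : (N n)%:R * `|emp_cdf Ys n w (y n j) - G (y n j)| <= e / 6.
  by move: j jN {i iN hX}; near: n; exact: aY.
have hXY : (N n)%:R * `|emp_joint_cdf Xs Ys n w (x n i) (y n j) - H (x n i) (y n j)| <= e / 6.
  by move: i j iN jN {hX hY}; near: n; exact: aXY.
have Nn : (N n)%:R <= e / 12 * n%:R by near: n.
have n0' : 0 < n%:R :> R by rewrite ltr0n.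
have := bilinear_ext_copula_near R A n (S n w) _ _ (F (x n i)) (G (y n j))
  (i%:R / (N n)%:R) (j%:R / (N n)%:R) cA n0 gS
  (emp_count_le Xs n w (x n i)) (emp_count_le Ys n w (y n j))
  (distr_fun01 _ _ _ _ _ _ mX) (distr_fun01 _ _ _ _ _ _ mY)
  (divr_grid01 _ _ _ iN) (divr_grid01 _ _ _ jN).
(* At the counts the subcopula is the joint empirical distribution function, and A(F, G) is H: the
   first error term becomes the deviation of one empirical frequency. *)
rewrite -hJ -AH -/(emp_cdf _ _ _ _) -/(emp_cdf _ _ _ _) => /(ler_wpM2l (ler0n R (N n))).
move=> h; apply: (le_trans h).
have nV : (n.+1%:R : R)^-1 <= n%:R^-1 by rewrite lef_pV2 ?posrE ?ltr0n// ler_nat.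
have N0 := ler0n R (N n).
have qX := ler_wpM2l N0 (le_trans (hx n i iN) nV).
have qY := ler_wpM2l N0 (le_trans (hy n j jN) nV).
have Nn' : (N n)%:R * n%:R^-1 <= e / 12 by rewrite ler_pdivrMr.
rewrite !mulrDr; move: hX hY hXY qX qY Nn'.
lra.
Unshelve. all: end_near. Qed.

Lemma emp_cdf01 (Z : nat -> T -> R) n w z : 0 <= emp_cdf Z n w z <= 1.
Proof. exact: divr_grid01 (emp_count_le _ _ _ _). Qed.

Lemma emp_cdf_range (Z : nat -> T -> R) n w : (0 < n)%N -> exists M, forall z,
  (M <= z -> emp_cdf Z n w z = 1) /\ (z < - M -> emp_cdf Z n w z = 0).
Proof.
move=> n0; exists (\sum_(i < n) `|Z i w|) => z.
have Zi (i : 'I_n) : `|Z i w| <= \sum_(i < n) `|Z i w|.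
  by rewrite (bigD1 i)//= lerDl sumr_ge0.
split=> hz; rewrite /emp_cdf /emp_count.
  rewrite (eq_bigr (fun=> 1%N)); last first.
    by move=> i _; rewrite (le_trans (ler_norm _))// (le_trans (Zi i)).
  by rewrite sum1_card card_ord divff// pnatr_eq0 -lt0n.
rewrite big1 ?mul0r// => i _; rewrite leNgt (lt_le_trans hz)//.
by rewrite lerNl (le_trans _ (Zi i))// -normrN ler_norm.
Qed.

Context (k : R -> R -> R) (kA : continuous_markov_kernel_of A k).

Let Kn n w x y := cb_kernel (N n) (bilinear_ext n (S n w)) (emp_cdf Xs n w x) (emp_cdf Ys n w y).

Lemma ae_cb_kernel_cvg x y : {ae P, forall w, forall e, 0 < e ->
  \forall n \near \oo, `|Kn n w x y - k (F x) (G y)| < e}.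
Proof.
(* Constant families of points give the convergence of F_n(x) and G_n(y). *)
have := ae_and _ _ (ae_and _ _ (ae_emp_cdfX (fun _ _ => x)) (ae_emp_cdfY (fun _ _ => y)))
  (ae_and _ _ hS ae_empirical_copula_near).
apply: filterS => w [[aX aY] [hw aC]] e e0.
have e6 : 0 < e / 6 by lra.
have [dl dl0 h] := cb_kernel_near R A k (F x) (G y) (e / 6) cA kA
  (distr_fun01 _ _ _ _ _ _ mX) (distr_fun01 _ _ _ _ _ _ mY) e6.
have dl2 : 0 < dl / 2 by lra.
have s0 : 0 < s by case/andP: s_itv.
near=> n.
have n0 : (0 < n)%N by near: n; exact: (nbhs_infty_gt 0%N).
have gS := (hw n n0).1.
have N0 : (0 < N n)%N by apply: Nn_gt0 => //; exact: ltW.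
have N1 : 1 <= (N n)%:R :> R by rewrite ler1n.
have Ndl : dl^-1 + 1 <= (N n)%:R by near: n; exact: Nn_infty.
have dX : (N n)%:R * `|emp_cdf Xs n w x - F x| <= dl / 2.
  by have : forall i, (i <= N n)%N -> (N n)%:R * `|emp_cdf Xs n w x - F x| <= dl / 2;
    [near: n; exact: aX|apply; exact: (leqnn (N n))].
have dY : (N n)%:R * `|emp_cdf Ys n w y - G y| <= dl / 2.
  by have : forall i, (i <= N n)%N -> (N n)%:R * `|emp_cdf Ys n w y - G y| <= dl / 2;
    [near: n; exact: aY|apply; exact: (leqnn (N n))].
have dC : forall i j, (i <= N n)%N -> (j <= N n)%N ->
    (N n)%:R * `|bilinear_ext n (S n w) (i%:R / (N n)%:R) (j%:R / (N n)%:R)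
                 - A (i%:R / (N n)%:R) (j%:R / (N n)%:R)| <= e / 6.
  by near: n; exact: aC.
have lt_dl z : (N n)%:R * `|z| <= dl / 2 -> `|z| < dl.
  move=> hz; have : `|z| <= (N n)%:R * `|z| by rewrite ler_peMl.
  lra.
apply: (@le_lt_trans _ _ (3 * (e / 6))); last by lra.
apply: h => //.
- rewrite -[ltRHS]invrK ltf_pV2 ?posrE ?invr_gt0 ?ltr0n//; lra.
- exact: emp_cdf01.
- exact: emp_cdf01.
- exact: lt_dl.
- exact: lt_dl.
- by move=> t t01; apply: bilinear_ext_0.
Unshelve. all: end_near. Qed.

Lemma ae_excess_quantiles_cvg0 tau x : 0 < tau < 1 -> {ae P, forall w,
  excess (qlow tau (Kn n w x)) (qup tau (Kn n w x))
    (qlow tau (fun y => k (F x) (G y))) (qup tau (fun y => k (F x) (G y)))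
  @[n --> \oo] --> (0 : R)}.
Proof.
move=> tau01; have /andP[t0 t1] := tau01.
pose K y := k (F x) (G y); pose c := qlow tau K; pose d' := qup tau K.
have Fx01 : 0 <= F x <= 1 by exact: distr_fun01.
have Gy01 y : 0 <= G y <= 1 by exact: distr_fun01.
have K_homo : {homo K : y z / y <= z}.
  move=> y z yz; have [_ [/(_ _ Fx01)[_ [_ km]] _]] := kA.
  have [/andP[y0 _] /andP[_ z1]] := (Gy01 y, Gy01 z).
  by apply: km => //; exact: distr_fun_homo.
have z01 : 0 <= (0 : R) <= 1 by rewrite lexx ler01.
have o01 : 0 <= (1 : R) <= 1 by rewrite lexx ler01.
(* G need not attain 0, so smallness of K comes from continuity of [k] at v = 0, where it vanishes,
   and from values of G arbitrarily close to 0. [K_hi] mirrors this at v = 1. *)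
have K_lo : exists y, K y < tau.
  have t2 : 0 < tau / 2 by lra.
  have [dl dl0 h] := kernel_cont R A k kA (F x) 0 _ Fx01 z01 t2.
  have [y hy] := distr_fun_lo R d T P Y dl mY dl0.
  exists y; have := h (F x) (G y) Fx01 (Gy01 y).
  rewrite subrr normr0 sub0r normrN ger0_norm; last by case/andP: (Gy01 y).
  rewrite (kernel_at0 R A k cA kA _ Fx01) subr0 => /(_ dl0 hy).
  by rewrite -/(K y) ler_norml => /andP[]; lra.
have K_hi : exists y, tau < K y.
  have t2 : 0 < (1 - tau) / 2 by lra.
  have [dl dl0 h] := kernel_cont R A k kA (F x) 1 _ Fx01 o01 t2.
  have [y hy] := distr_fun_hi R d T P Y dl mY dl0.
  exists y; have := h (F x) (G y) Fx01 (Gy01 y).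
  have hy' : 1 - G y < dl by rewrite ltrBlDr -ltrBlDl.
  rewrite subrr normr0 ger0_norm; last by rewrite subr_ge0; case/andP: (Gy01 y).
  have [_ [/(_ _ Fx01)[_ [-> _]] _]] := kA => /(_ dl0 hy').
  by rewrite -/(K y) ler_norml => /andP[]; lra.
have := ae_and _ _ hS (ae_and _ _
  (ae_foralln (fun m => ae_cb_kernel_cvg x (c - m.+1%:R^-1)))
  (ae_foralln (fun m => ae_cb_kernel_cvg x (d' + m.+1%:R^-1)))).
apply: filterS => w [hw [hc hd]].
apply: (excess_cvg0 R tau (fun n => Kn n w x) K tau01 K_homo K_lo K_hi) => //.
near=> n.
have n0 : (0 < n)%N by near: n; exact: (nbhs_infty_gt 0%N).
have gS := (hw n n0).1.
have N0 : (0 < N n)%N by apply: Nn_gt0 => //; case/andP: s_itv => /ltW.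
have [M hM] := emp_cdf_range Ys n w n0.
exists M => y; split=> hy; rewrite /Kn.
  rewrite (proj1 (hM y) hy) cb_kernel_1 ?emp_cdf01// => t t01.
  by split; [exact: bilinear_ext_0|exact: bilinear_ext_1].
by rewrite (proj2 (hM y) hy) cb_kernel_0 ?emp_cdf01.
Unshelve. all: end_near. Qed.

End sample.

Theorem theorem5p6 (R : realType) (d : measure_display) (T : measurableType d)
  (P : probability T R) (X Y : T -> R) (Xs Ys : nat -> T -> R)
  (mX : measurable_fun setT X) (mY : measurable_fun setT Y)
  (mXs : forall i, measurable_fun setT (Xs i))
  (mYs : forall i, measurable_fun setT (Ys i))
  (hiid : iid_sample P X Y Xs Ys)
  (hHcont : continuous (fun p : R * R => joint_cdf P X Y p.1 p.2))
  (A : R -> R -> R) (hA : is_copula A)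
  (hAH : forall x y, joint_cdf P X Y x y = A (distr_fun P X x) (distr_fun P Y y))
  (k : R -> R -> R) (hk : continuous_markov_kernel_of A k)
  (s : R) (hs : 0 < s < 1 / 2)
  (tau : R) (htau : 0 < tau < 1)
  (S : nat -> T -> nat -> nat -> R) (hS : empirical_subcopula P Xs Ys S) :
  forall x : R,
  {ae P, forall w,
    (fun n : nat =>
       excess
         (qlow tau (fun y => cb_kernel (Nn s n) (bilinear_ext n (S n w))
                               (emp_cdf Xs n w x) (emp_cdf Ys n w y)))
         (qup tau (fun y => cb_kernel (Nn s n) (bilinear_ext n (S n w))
                               (emp_cdf Xs n w x) (emp_cdf Ys n w y)))
         (qlow tau (fun y => k (distr_fun P X x) (distr_fun P Y y)))
         (qup tau (fun y => k (distr_fun P X x) (distr_fun P Y y))))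
    @ \oo --> (0 : R)}.
Proof.
move=> x.
exact: (ae_excess_quantiles_cvg0 R d T P X Y Xs Ys mX mY mXs mYs hiid s hs
  A hA hAH hHcont S hS k hk tau x htau).
Qed.
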